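(* Let $n \geq 2$, $0 \le \theta < n/2$, and suppose $h \in \mathcal{H}^\theta_{\alpha,\omega}(\mathbf{R}^n)$ for some $\alpha \geq 0$, $\omega > 0$. If $\theta = 1$, then $\mathcal{F}_h \hookrightarrow PM^{n-1} \hookrightarrow BMO^{-1}$. If $0 < \theta < 1$, then $\mathcal{F}_h \hookrightarrow PM^{n-\theta} \hookrightarrow BMO_T^{-1}$ for all $T > 0$.
   Context: A majorizing kernel with exponent $\theta \geq 0$ on $\mathbf{R}^n$ is a tempered function (a measurable function that is also a tempered distribution) $h : \mathbf{R}^n \to (0,\infty]$ such that: (i) there is a constant $B > 0$ with $h*h(\xi) = \int_{\mathbf{R}^n} h(\xi-\eta)h(\eta)\,d\eta \leq B|\xi|^\theta h(\xi)$ for all $\xi \in \mathbf{R}^n$; (ii) $h^{-1}(\infty)$ has $n$-dimensional Lebesgue measure zero. In (i) the value $|\xi|^\theta h(\xi)$ is taken to be $\infty$ whenever $h(\xi)=\infty$ (including at $\xi = 0$), and $|0|^0=1$. $\mathcal{H}^\theta(\mathbf{R}^n)$ denotes the set of all such $h$. $\mathcal{H}^\theta_{\alpha,\omega}(\mathbf{R}^n)$, with $\alpha \geq 0$ and $\omega > 0$, denotes the set of $h \in \mathcal{H}^\theta(\mathbf{R}^n)$ such that: (1) $h(\xi) = O(|\xi|^{-\alpha})$ and $|\xi|^{-\alpha} = O(h(\xi))$ as $\xi \to 0$; (2) $h(\xi) = O(|\xi|^{-\omega})$ and $|\xi|^{-\omega} = O(h(\xi))$ as $|\xi| \to \infty$;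 (3) $h$ is bounded on the complement of any neighborhood of the origin. The majorization space of $h$ is $\mathcal{F}_h = \{ f \in \mathcal{S}'(\mathbf{R}^n)^n : \hat f \in L^1_{\rm loc}(\mathbf{R}^n)^n,\ \|f\|_{\mathcal{F}_h} = \sup_{\xi \in \mathbf{R}^n} [h(\xi)]^{-1}|\hat f(\xi)| < \infty \}$, where $\hat f$ is the Fourier transform and the supremum is read as an essential supremum since $\hat f$ is defined almost everywhere. For $a \geq 0$, the pseudomeasure space is $PM^a = \{ f \in \mathcal{S}'(\mathbf{R}^n) : \hat f \in L^1_{\rm loc}(\mathbf{R}^n),\ \|f\|_{PM^a} = \operatorname{ess\,sup}_{\xi} |\xi|^a|\hat f(\xi)| < \infty \}$. With $e^{t\Delta}$ the heat semigroup, $BMO^{-1}$ is the space of tempered distributions $f$ on $\mathbf{R}^n$ with finite norm $\|f\|_{BMO^{-1}} = \sup_{x \in \mathbf{R}^n,\, R>0} \big( \frac{1}{|B(x,R)|} \int_0^{R^2}\int_{B(x,R)} |e^{t\Delta}f|^2\,dy\,dt \big)^{1/2}$, and for $T>0$, $BMO_T^{-1}$ is defined in the same way with norm $\|f\|_{BMO_T^{-1}} = \sup_{x \in \mathbf{R}^n,\, 0<R^2<T} \big( \frac{1}{|B(x,R)|} \int_0^{R^2}\int_{B(x,R)} |e^{t\Delta}f|^2\,dy\,dt \big)^{1/2}$. Here $B(x,R)$ is the ball of radius $R$ centered at $x$ and $|B(x,R)|$ its Lebesgue measure. The distinction between spaces of scalar-valued and vector-valued functions is ignored (vector-valued versions are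 understood componentwise). $X \hookrightarrow Y$ denotes continuous embedding: $X \subseteq Y$ and $\|f\|_Y \leq C\|f\|_X$ for all $f \in X$, with a constant $C$ independent of $f$. *)

(* Defs.v *)
From HB Require Import structures.
From mathcomp Require Import all_boot all_order all_algebra.
From mathcomp Require Import all_classical all_reals all_analysis.
From mathcomp Require Import measurable_realfun ess_sup_inf complex.
Set Implicit Arguments.
Unset Strict Implicit.
Unset Printing Implicit Defensive.
Import Order.TTheory GRing.Theory Num.Theory.
Import numFieldNormedType.Exports.
Local Open Scope classical_set_scope.
Local Open Scope complex_scope.
Local Open Scope ring_scope.

(* R^n is 'rV[R]_n.  Its sigma-algebra is the one generated by the coordinate
   functions, i.e. the Borel sigma-algebra.  The norm `|x| that the library
   puts on 'rV[R]_n is the sup norm; it is used here only for its topology. *)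

Definition rV_display : measure_display.
Proof. exact: default_measure_display. Qed.

Definition rV_coord (R : realType) (n : nat) (i : 'I_n) (x : 'rV[R]_n) :
  measurableTypeR R := x ord0 i.

Section rV_measurable.
Context (R : realType) (n : nat).

Let rV_measurable : set (set 'rV[R]_n) := g_sigma_preimage (@rV_coord R n).

Let rV_measurable0 : rV_measurable set0.
Proof. exact: sigma_algebra0. Qed.

Let rV_measurableC A : rV_measurable A -> rV_measurable (~` A).
Proof. exact: sigma_algebraC. Qed.

Let rV_measurable_bigcup (F : (set 'rV[R]_n)^nat) :
  (forall i, rV_measurable (F i)) -> rV_measurable (\bigcup_i F i).
Proof. exact: sigma_algebra_bigcup. Qed.

HB.instance Definition _ := @isMeasurable.Build rV_display 'rV[R]_n
  rV_measurable rV_measurable0 rV_measurableC rV_measurable_bigcup.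

End rV_measurable.

Lemma measurable_rV_coord (R : realType) (n : nat) (i : 'I_n) :
  measurable_fun [set: 'rV[R]_n] (@rV_coord R n i).
Proof.
move=> _ Y mY; rewrite setTI; apply: sub_sigma_algebra => /=.
rewrite -bigcup_seq/=; exists i => /=; first by rewrite mem_index_enum.
by exists Y => //; rewrite setTI.
Qed.

Lemma measurable_fun_rVP (R : realType) (n : nat) d (T : measurableType d)
    (f : T -> 'rV[R]_n) :
  measurable_fun [set: T] f <->
  forall i, measurable_fun [set: T] (@rV_coord R n i \o f).
Proof.
split=> [mf i|mf]; first exact: measurableT_comp (measurable_rV_coord i) mf.
move=> _; apply: smallest_sub.
  split; first by rewrite preimage_set0 setI0.
  - move=> A; rewrite !setTI setTD -preimage_setC => ?; exact: measurableC.
  - by move=> F mF; rewrite setTI preimage_bigcup; apply: bigcupT_measurable => i;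
      rewrite -[X in measurable X]setTI; exact: mF.
rewrite -bigcup_seq; apply: bigcup_sub => i _ A [B mB <-] /=.
by rewrite !setTI -[X in measurable X]setTI; exact: mf.
Qed.

Definition rV_cons (R : realType) (n : nat) (p : measurableTypeR R * 'rV[R]_n) :
  'rV[R]_n.+1 :=
  \row_i (if unlift ord0 i is Some j then p.2 ord0 j else p.1).

Definition rV_uncons (R : realType) (n : nat) (x : 'rV[R]_n.+1) :
  measurableTypeR R * 'rV[R]_n :=
  (x ord0 ord0, \row_j x ord0 (lift ord0 j)).

Lemma rV_consK (R : realType) (n : nat) : cancel (@rV_cons R n) (@rV_uncons R n).
Proof.
move=> [a v]; rewrite /rV_cons /rV_uncons mxE unlift_none; congr pair.
by apply/rowP => j; rewrite !mxE liftK.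
Qed.

Lemma rV_unconsK (R : realType) (n : nat) :
  cancel (@rV_uncons R n) (@rV_cons R n).
Proof.
move=> x; apply/rowP => i; rewrite mxE.
by case: unliftP => [j ->|->] //=; rewrite mxE.
Qed.

Lemma measurable_rV_cons (R : realType) (n : nat) :
  measurable_fun setT (@rV_cons R n).
Proof.
apply/measurable_fun_rVP => i.
case: (unliftP ord0 i) => [j ->|->].
  rewrite (_ : _ \o _ = @rV_coord R n j \o snd); last first.
    by apply/funext => p /=; rewrite /rV_coord mxE liftK.
  exact: measurableT_comp (measurable_rV_coord j) measurable_snd.
rewrite (_ : _ \o _ = fst) //.
by apply/funext => p /=; rewrite /rV_coord mxE unlift_none.
Qed.

Lemma measurable_rV_uncons (R : realType) (n : nat) :
  measurable_fun setT (@rV_uncons R n).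
Proof.
apply: measurable_fun_pair; first exact: (measurable_rV_coord ord0).
apply/measurable_fun_rVP => j.
rewrite (_ : _ \o _ = @rV_coord R n.+1 (lift ord0 j)).
  exact: measurable_rV_coord.
by apply/funext => x; rewrite /rV_coord /= mxE.
Qed.

Section lebesgue_rV_succ.
Context (R : realType) (n : nat).
Variable mu : {sigma_finite_measure set 'rV[R]_n -> \bar R}.

Definition lebesgue_rV_succ : set 'rV[R]_n.+1 -> \bar R :=
  pushforward (lebesgue_measure \x mu)%E (@rV_cons R n).

Let mcons := @measurable_rV_cons R n.

Let succ0 : lebesgue_rV_succ set0 = 0%E.
Proof. by rewrite /lebesgue_rV_succ /pushforward preimage_set0 measure0. Qed.

Let succ_ge0 A : (0 <= lebesgue_rV_succ A)%E.
Proof. exact: measure_ge0. Qed.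

Let succ_sigma_additive : semi_sigma_additive lebesgue_rV_succ.
Proof.
move=> F mF tF mUF; rewrite /lebesgue_rV_succ /pushforward preimage_bigcup.
apply: measure_semi_sigma_additive.
- by move=> k; rewrite -[X in measurable X]setTI; exact: mcons.
- apply/trivIsetP => /= i j _ _ ij; rewrite -preimage_setI.
  by move/trivIsetP : tF => /(_ _ _ _ _ ij) ->//; rewrite preimage_set0.
- by rewrite -preimage_bigcup -[X in measurable X]setTI; exact: mcons.
Qed.

HB.instance Definition _ := isMeasure.Build _ _ _ lebesgue_rV_succ
  succ0 succ_ge0 succ_sigma_additive.

Let succ_sigma_finite : sigma_finite setT lebesgue_rV_succ.
Proof.
have /sigma_finiteP[F [TF ndF Foo]] := sigma_finiteT (@lebesgue_measure R).
have /sigma_finiteP[G [TG ndG Goo]] := sigma_finiteT mu.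
exists (fun k => @rV_uncons R n @^-1` (F k `*` G k)).
  rewrite -preimage_bigcup (_ : \bigcup_k _ = setT) ?preimage_setT//.
  apply/seteqP; split=> // -[x y] _.
  have : [set: measurableTypeR R] x by []. rewrite TF => -[i _ Fx].
  have : [set: 'rV[R]_n] y by []. rewrite TG => -[j _ Gy].
  exists (maxn i j) => //; split => /=.
  - by move: x Fx; exact/subsetPset/ndF/leq_maxl.
  - by move: y Gy; exact/subsetPset/ndG/leq_maxr.
move=> k; have [mF Fk] := Foo k; have [mG Gk] := Goo k; split.
  rewrite -[X in measurable X]setTI; apply: measurable_rV_uncons => //.
  exact: measurableX.
rewrite /lebesgue_rV_succ /pushforward -comp_preimage.
rewrite (_ : _ \o _ = id) ?preimage_id; last first.
  by apply/funext => p /=; rewrite rV_consK.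
by rewrite product_measure1E// lte_mul_pinfty// ge0_fin_numE.
Qed.

HB.instance Definition _ := Measure_isSigmaFinite.Build _ _ _ lebesgue_rV_succ
  succ_sigma_finite.

End lebesgue_rV_succ.

(* n-dimensional Lebesgue measure: the n-fold product of the Lebesgue measure
   on R, transported to row vectors. *)
Fixpoint lebesgue_rV (R : realType) (n : nat) :
    {sigma_finite_measure set 'rV[R]_n -> \bar R} :=
  if n is m.+1 then lebesgue_rV_succ (@lebesgue_rV R m)
  else \d_ (0 : 'rV[R]_0).

Arguments lebesgue_rV {R n}.

Definition dotp (R : realType) (n : nat) (x y : 'rV[R]_n) : R :=
  \sum_(i < n) x ord0 i * y ord0 i.

Definition enorm (R : realType) (n : nat) (x : 'rV[R]_n) : R :=
  Num.sqrt (dotp x x).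

Definition eball (R : realType) (n : nat) (x : 'rV[R]_n) (r : R) :
    set 'rV[R]_n :=
  [set y | enorm (y - x) < r].

Definition cintegral (R : realType) (n : nat) (f : 'rV[R]_n -> R[i]) : R[i] :=
  (\int[lebesgue_rV]_x complex.Re (f x)) +i*
  (\int[lebesgue_rV]_x complex.Im (f x)).

Definition integrableC (R : realType) (n : nat) (f : 'rV[R]_n -> R[i]) : Prop :=
  (\int[lebesgue_rV]_x (Normc.normc (f x))%:E < +oo)%E.

(* Iterated partial derivative along the list of directions s. *)
Definition pderiv (R : realType) (n : nat) (s : seq 'I_n)
    (u : 'rV[R]_n -> R) : 'rV[R]_n -> R :=
  foldr (fun j (v : 'rV[R]_n -> R) => fun x => 'D_(delta_mx ord0 j) v x) u s.

Definition smooth (R : realType) (n : nat) (u : 'rV[R]_n -> R) : Prop :=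
  forall s : seq 'I_n, continuous (pderiv s u) /\
    forall (j : 'I_n) (x : 'rV[R]_n),
      derivable (pderiv s u) x (delta_mx ord0 j).

Definition cpderiv (R : realType) (n : nat) (s : seq 'I_n)
    (phi : 'rV[R]_n -> R[i]) (x : 'rV[R]_n) : R[i] :=
  pderiv s (fun y => complex.Re (phi y)) x +i*
  pderiv s (fun y => complex.Im (phi y)) x.

Definition schwartz_seminorm (R : realType) (n : nat) (N : nat)
    (phi : 'rV[R]_n -> R[i]) : \bar R :=
  ereal_sup [set z | exists (s : seq 'I_n) (x : 'rV[R]_n), (size s <= N)%N /\
    z = ((1 + enorm x) ^+ N * Normc.normc (cpderiv s phi x))%:E].

Definition schwartz (R : realType) (n : nat) : set ('rV[R]_n -> R[i]) :=
  [set phi | [/\ smooth (fun x => complex.Re (phi x)),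
                 smooth (fun x => complex.Im (phi x)) &
                 forall N, (schwartz_seminorm N phi < +oo)%E]].

(* A distribution is represented by a functional defined on all functions
   R^n -> C, of which only the values on Schwartz functions matter: nothing
   below evaluates it anywhere else. *)
Definition functional (R : realType) (n : nat) : Type :=
  ('rV[R]_n -> R[i]) -> R[i].

Definition tempered (R : realType) (n : nat) : set (functional R n) :=
  [set f |
    (forall (a : R[i]) (phi psi : 'rV[R]_n -> R[i]),
      schwartz phi -> schwartz psi ->
      f (fun x => a * phi x + psi x) = a * f phi + f psi) /\
    (exists (N : nat) (C : R), forall phi, schwartz phi ->
      ((Normc.normc (f phi))%:E <= C%:E * schwartz_seminorm N phi)%E)].

(* phi^(xi) = \int e^{- i x . xi} phi(x) dx *)
Definition fourier (R : realType) (n : nat) (phi : 'rV[R]_n -> R[i])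
    (xi : 'rV[R]_n) : R[i] :=
  cintegral (fun x => (cos (dotp x xi) -i* sin (dotp x xi)) * phi x).

Definition fourierD (R : realType) (n : nat) (f : functional R n) :
    functional R n :=
  fun phi => f (fourier phi).

Definition L1loc (R : realType) (n : nat) : set ('rV[R]_n -> R[i]) :=
  [set g : 'rV[R]_n -> R[i] |
    [/\ measurable_fun [set: 'rV[R]_n] (fun x => complex.Re (g x)),
        measurable_fun [set: 'rV[R]_n] (fun x => complex.Im (g x)) &
        forall K : set 'rV[R]_n, compact K ->
          (\int[lebesgue_rV]_(x in K) (Normc.normc (g x))%:E < +oo)%E]].

(* The tempered distribution f is the locally integrable function g: f is
   given by integration against g.  The test functions include C_c^\infty; a
   Schwartz function is tested as soon as its product with g is integrable,
   which for a general g in L^1_loc may fail. *)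
Definition is_function (R : realType) (n : nat) (f : functional R n)
    (g : 'rV[R]_n -> R[i]) : Prop :=
  forall phi, schwartz phi -> integrableC (fun x => g x * phi x) ->
    f phi = cintegral (fun x => g x * phi x).

Definition fourier_L1loc (R : realType) (n : nat) : set (functional R n) :=
  [set f | exists g, L1loc g /\ is_function (fourierD f) g].

(* The function f^ (defined up to a null set) when f is in fourier_L1loc. *)
Definition fhat (R : realType) (n : nat) (f : functional R n) :
    'rV[R]_n -> R[i] :=
  xget (fun=> 0) [set g | L1loc g /\ is_function (fourierD f) g].

(* Measurability with respect to the completed (Lebesgue) sigma-algebra. *)
Definition lebesgue_measurable_fun (R : realType) (n : nat)
    (h : 'rV[R]_n -> \bar R) : Prop :=
  exists2 h' : 'rV[R]_n -> \bar R,
    measurable_fun [set: 'rV[R]_n] h' & \forall x \ae lebesgue_rV, h x = h' x.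

Definition tempered_function (R : realType) (n : nat)
    (h : 'rV[R]_n -> \bar R) : Prop :=
  [/\ lebesgue_measurable_fun h,
      forall phi, schwartz phi ->
        (\int[lebesgue_rV]_x (h x * (Normc.normc (phi x))%:E) < +oo)%E &
      tempered (fun phi => cintegral (fun x => (fine (h x))%:C * phi x))].

(* |xi|^theta h(xi), equal to +oo whenever h(xi) = +oo, and with |0|^0 = 1 *)
Definition weighted (R : realType) (n : nat) (theta : R)
    (h : 'rV[R]_n -> \bar R) (xi : 'rV[R]_n) : \bar R :=
  if h xi == +oo%E then +oo%E else ((enorm xi `^ theta)%:E * h xi)%E.

Definition majorizing_kernel (R : realType) (n : nat) (theta : R) :
    set ('rV[R]_n -> \bar R) :=
  [set h : 'rV[R]_n -> \bar R | [/\ tempered_function h,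
      forall xi, (0 < h xi)%E,
      exists2 B : R, 0 < B & forall xi : 'rV[R]_n,
        (\int[lebesgue_rV]_eta (h (xi - eta)%R * h eta)
          <= B%:E * weighted theta h xi)%E &
      lebesgue_rV.-negligible (h @^-1` [set +oo%E])]].

Definition majorizing_kernel_growth (R : realType) (n : nat)
    (theta alpha omega : R) : set ('rV[R]_n -> \bar R) :=
  [set h : 'rV[R]_n -> \bar R | majorizing_kernel theta h /\
    [/\ (exists C : R, \forall xi \near (0 : 'rV[R]_n)^',
           (h xi <= (C * enorm xi `^ (- alpha))%:E)%E),
        (exists C : R, \forall xi \near (0 : 'rV[R]_n)^',
           ((enorm xi `^ (- alpha))%:E <= C%:E * h xi)%E),
        (exists C r : R, forall xi, r < enorm xi ->
           (h xi <= (C * enorm xi `^ (- omega))%:E)%E),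
        (exists C r : R, forall xi, r < enorm xi ->
           ((enorm xi `^ (- omega))%:E <= C%:E * h xi)%E) &
        forall U : set 'rV[R]_n, nbhs (0 : 'rV[R]_n) U ->
          exists M : R, forall xi, ~ U xi -> (h xi <= M%:E)%E]].

Record normed_space (R : realType) (T : Type) := NormedSpace {
  carrier : set T ;
  norm_of : T -> \bar R }.

Definition embedded (R : realType) (T : Type) (X Y : normed_space R T) : Prop :=
  carrier X `<=` carrier Y /\
  exists2 C : R, 0 < C & forall f, carrier X f ->
    (norm_of Y f <= C%:E * norm_of X f)%E.

(* X^m, normed by the sum of the norms of the components. *)
Definition vectors (R : realType) (T : Type) (m : nat) (X : normed_space R T) :
    normed_space R ('I_m -> T) :=
  NormedSpace [set f | forall j, carrier X (f j)]
              (fun f => \sum_(j < m) norm_of X (f j))%E.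

Definition majorization_norm (R : realType) (n : nat) (h : 'rV[R]_n -> \bar R)
    (f : 'I_n -> functional R n) : \bar R :=
  ess_sup lebesgue_rV (fun xi => (h xi)^-1 *
    (Num.sqrt (\sum_(j < n) Normc.normc (fhat (f j) xi) ^+ 2))%:E)%E.

Definition majorization_space (R : realType) (n : nat)
    (h : 'rV[R]_n -> \bar R) : normed_space R ('I_n -> functional R n) :=
  NormedSpace [set f | [/\ forall j, tempered (f j),
                           forall j, fourier_L1loc (f j) &
                           (majorization_norm h f < +oo)%E]]
              (majorization_norm h).

Definition PM_norm (R : realType) (n : nat) (a : R) (f : functional R n) :
    \bar R :=
  ess_sup lebesgue_rV (fun xi =>
    (enorm xi `^ a * Normc.normc (fhat f xi))%:E).

Definition PM (R : realType) (n : nat) (a : R) :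
    normed_space R (functional R n) :=
  NormedSpace [set f | [/\ tempered f, fourier_L1loc f &
                           (PM_norm a f < +oo)%E]]
              (PM_norm a).

Definition heat_kernel (R : realType) (n : nat) (t : R) (z : 'rV[R]_n) : R :=
  (4 * pi * t) `^ (- (n%:R / 2)) * expR (- (enorm z ^+ 2 / (4 * t))).

(* e^{t Delta} f is the smooth function given by the convolution of the
   tempered distribution f with the heat kernel. *)
Definition heat (R : realType) (n : nat) (t : R) (f : functional R n)
    (x : 'rV[R]_n) : R[i] :=
  f (fun y => (heat_kernel t (x - y))%:C).

Definition heat_mean (R : realType) (n : nat) (f : functional R n)
    (x : 'rV[R]_n) (r : R) : \bar R :=
  (poweR ((lebesgue_rV (eball x r))^-1 *
     \int[lebesgue_measure]_(t in `]0%R, (r ^+ 2)%R[)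
       \int[lebesgue_rV]_(y in eball x r)
         ((Normc.normc (heat t f y)) ^+ 2)%:E)
     (2^-1)%R)%E.

Definition BMOm1_norm (R : realType) (n : nat) (f : functional R n) : \bar R :=
  ereal_sup [set z | exists (x : 'rV[R]_n) (r : R),
    0 < r /\ z = heat_mean f x r].

Definition BMOm1 (R : realType) (n : nat) : normed_space R (functional R n) :=
  NormedSpace [set f | tempered f /\ (BMOm1_norm f < +oo)%E] (@BMOm1_norm R n).

Definition BMOm1T_norm (R : realType) (n : nat) (T : R) (f : functional R n) :
    \bar R :=
  ereal_sup [set z | exists (x : 'rV[R]_n) (r : R),
    [/\ 0 < r, r ^+ 2 < T & z = heat_mean f x r]].

Definition BMOm1T (R : realType) (n : nat) (T : R) :
    normed_space R (functional R n) :=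
  NormedSpace [set f | tempered f /\ (BMOm1T_norm T f < +oo)%E]
              (BMOm1T_norm T).

(* Main.v *)
(* Kernel bound: on the ball of radius |xi|/4 around xi/2, both factors of
   h(xi - eta) h(eta) are at least of the order of |xi|^{-p} when h is bounded
   below by a multiple of |.|^{-p}; hence h * h(xi) >= c |xi|^{n - 2p}. Comparing
   with B |xi|^theta h(xi) as xi -> 0 (p = alpha) and as |xi| -> oo (p = omega)
   gives alpha <= n - theta <= omega, and then h <= C |.|^{theta - n}.

   Heat extension: if |f^(xi)| <= K |xi|^{theta - n}, then e^{t Delta} f is the
   absolutely convergent integral of f^(xi) e^{i x.xi - t |xi|^2}, up to
   (2 pi)^{-n}. Majorize the indicator of B(x,r) by the Gaussian of width r,
   expand the square of the modulus and integrate in y first: the integral of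
   |e^{t Delta} f|^2 over B(x,r) is at most a constant times
     K^2 r^n \int \int |xi|^{theta-n} |eta|^{theta-n} e^{- r^2 |xi - eta|^2 / 4}.
   Since |xi|^{-1} <= |xi_i|^{-1}, the double integral is dominated by a product
   of n one-dimensional ones, with |xi_i|^{-b}, b = (n - theta)/n. They converge
   because 1/2 < b < 1 (this is where theta < n/2 enters) and scale like
   r^{2b - 2}. The bound K^2 r^{n - 2 theta} is uniform in t, so averaging over
   0 < t < r^2 yields K^2 r^{2 - 2 theta}. *)
From HB Require Import structures.
Require Import Defs.
From mathcomp Require Import all_boot all_order all_algebra.
From mathcomp Require Import all_classical all_reals all_analysis.
From mathcomp Require Import measurable_realfun ess_sup_inf complex.
From mathcomp Require Import ring lra.
Set Implicit Arguments.
Unset Strict Implicit.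
Unset Printing Implicit Defensive.
Import Order.TTheory GRing.Theory Num.Theory.
Import numFieldNormedType.Exports.
Local Open Scope classical_set_scope.
Local Open Scope complex_scope.
Local Open Scope ring_scope.

(** * Integration on row vectors *)

(** By definition e^{t Delta} f evaluates the distribution f on a heat kernel, whereas f^ is known
    only through Schwartz functions whose product with it is integrable. The bridge is an explicit
    Schwartz function, [heat_symbol], whose Fourier transform is exactly the translated heat kernel.
    This is why a good part of the proof computes Gaussian Fourier integrals and checks that
    modulated Gaussians are Schwartz.

    The second device is factorization. Gaussians, cubes and the majorizing weight are all products
    over the coordinates, so Tonelli reduces each n-dimensional estimate to the line.

    The factor e^{- t |xi|^2} plays two roles. For fixed t it makes f^ times the symbol absolutely
    integrable, as every exchange of integrals requires; afterwards it is bounded by 1, and this is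
    the source of the uniformity in t. *)

Section monotone_integral.
Context d (T : measurableType d) (R : realType) (mu : {measure set T -> \bar R}).

(* The integral of a nonnegative function is a supremum over the simple
   functions below it, hence no measurability is required. *)
Lemma ge0_integral_mono (D : set T) (f g : T -> \bar R) :
  (forall x, D x -> (0 <= f x)%E) -> (forall x, D x -> (f x <= g x)%E) ->
  (\int[mu]_(x in D) f x <= \int[mu]_(x in D) g x)%E.
Proof.
move=> f0 fg.
have g0 x : D x -> (0 <= g x)%E by move=> Dx; exact: le_trans (f0 x Dx) (fg x Dx).
rewrite !ge0_integralE//.
apply: ereal_sup_le => _ [h /= hf <-]; exists h => //= x; apply: le_trans (hf x) _; rewrite /patch; case: ifPn => //.
by rewrite inE; exact: fg.
Qed.

(** Only the majorant has a sign: the negative part of [f] can only lower its integral, and the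
    positive part stays below [g]. The signed case serves the oscillating inner integrals in
    [heat_energy_le]. *)
Lemma integral_le_ge0 (f g : T -> \bar R) :
  (forall x, 0 <= g x)%E -> (forall x, f x <= g x)%E ->
  (\int[mu]_x f x <= \int[mu]_x g x)%E.
Proof.
move=> g0 fg; rewrite integralE; apply: (@le_trans _ _ (\int[mu]_x (f^\+ x))%E).
  by rewrite -[leRHS]sube0; apply: leeB => //; exact: integral_ge0.
apply: ge0_integral_mono => x _; first exact: funepos_ge0.
by rewrite funeposE ge_max fg g0.
Qed.

End monotone_integral.

Section rV_measurability.
Context (R : realType).

Lemma measurable_dotp d (T : measurableType d) n (f g : T -> 'rV[R]_n) :
  measurable_fun setT f -> measurable_fun setT g ->
  measurable_fun setT (fun t => dotp (f t) (g t)).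
Proof.
move=> /measurable_fun_rVP mf /measurable_fun_rVP mg.
apply: measurable_sum => i; apply: measurable_funM.
  exact: (mf i).
exact: (mg i).
Qed.

Lemma measurable_rVB d (T : measurableType d) n (f g : T -> 'rV[R]_n) :
  measurable_fun setT f -> measurable_fun setT g ->
  measurable_fun setT (fun t => f t - g t).
Proof.
move=> /measurable_fun_rVP mf /measurable_fun_rVP mg; apply/measurable_fun_rVP => i.
rewrite (_ : _ \o _ = fun t => f t ord0 i - g t ord0 i).
  by apply: measurable_funB; [exact: (mf i)|exact: (mg i)].
by apply/funext => t /=; rewrite /rV_coord !mxE.
Qed.

Lemma measurable_enorm d (T : measurableType d) n (f : T -> 'rV[R]_n) :
  measurable_fun setT f -> measurable_fun setT (fun t => enorm (f t)).
Proof.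
move=> mf; apply: (measurableT_comp (f := @Num.sqrt R) (g := fun t => dotp (f t) (f t))).
  by apply: continuous_measurable_fun; exact: sqrt_continuous.
exact: measurable_dotp.
Qed.

Lemma measurable_eball n (x : 'rV[R]_n) r : measurable (eball x r).
Proof.
rewrite (_ : eball x r = setT `&` (fun y => enorm (y - x)) @^-1` [set` `]-oo, r[]).
  have : measurable_fun setT (fun y : 'rV[R]_n => enorm (y - x)).
    by apply: measurable_enorm; apply: measurable_rVB.
  by apply => //; exact: measurable_itv.
by rewrite setTI; apply/seteqP; split => y /=; rewrite in_itv.
Qed.

End rV_measurability.

Section dotp_enorm.
Context (R : realType) (n : nat).
Implicit Types x y : 'rV[R]_n.

Lemma dotp_ge0 x : 0 <= dotp x x.
Proof. by apply: sumr_ge0 => i _; rewrite -expr2 sqr_ge0. Qed.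

Lemma enorm_ge0 x : 0 <= enorm x.
Proof. exact: sqrtr_ge0. Qed.

Lemma sqr_enorm x : enorm x ^+ 2 = \sum_(i < n) x ord0 i ^+ 2.
Proof. by rewrite sqr_sqrtr ?dotp_ge0//; apply: eq_bigr => i _; rewrite expr2. Qed.

Lemma coord_le_enorm x i : `|x ord0 i| <= enorm x.
Proof.
rewrite -(ler_pXn2r (n := 2)) ?nnegrE ?enorm_ge0//.
rewrite sqr_enorm real_normK ?num_real// (bigD1 i)//= lerDl.
by apply: sumr_ge0 => j _; rewrite sqr_ge0.
Qed.

Lemma enorm_eq0 x : (enorm x == 0) = (x == 0).
Proof.
apply/idP/eqP => [/eqP x0|->].
  apply/rowP => i; rewrite mxE; apply/eqP; rewrite -normr_le0 -x0.
  exact: coord_le_enorm.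
by rewrite -sqrf_eq0 sqr_enorm big1// => i _; rewrite mxE expr0n.
Qed.

Lemma enorm_gt0 x : (0 < enorm x) = (x != 0).
Proof. by rewrite lt_def enorm_ge0 andbT enorm_eq0. Qed.

Lemma dotpC x y : dotp x y = dotp y x.
Proof. by apply: eq_bigr => i _; rewrite mulrC. Qed.

Lemma dotpBl x y z : dotp (x - y) z = dotp x z - dotp y z.
Proof. by rewrite /dotp -sumrB; apply: eq_bigr => i _; rewrite !mxE mulrBl. Qed.

Lemma dotpBr x y z : dotp z (x - y) = dotp z x - dotp z y.
Proof. by rewrite dotpC dotpBl !(dotpC z). Qed.

Lemma dotpZl a x y : dotp (a *: x) y = a * dotp x y.
Proof. by rewrite /dotp mulr_sumr; apply: eq_bigr => i _; rewrite mxE mulrA. Qed.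

Lemma enorm_delta i : enorm (delta_mx ord0 i : 'rV[R]_n) = 1.
Proof.
rewrite -[RHS]sqrtr1; congr Num.sqrt; rewrite /dotp (bigD1 i)//= big1.
  by rewrite mxE !eqxx mulr1 addr0.
by move=> j ji; rewrite mxE (negbTE ji) andbF mul0r.
Qed.

Lemma enormZ a x : enorm (a *: x) = `|a| * enorm x.
Proof. by rewrite /enorm dotpZl dotpC dotpZl mulrA -expr2 sqrtrM ?sqr_ge0// sqrtr_sqr. Qed.

(* Expanding |x - s y|^2 >= 0 at s = |x|/|y| gives Cauchy-Schwarz. *)
Lemma dotp_le x y : dotp x y <= enorm x * enorm y.
Proof.
have [->|y0] := eqVneq y 0.
  rewrite /dotp big1; first by rewrite mulr_ge0// enorm_ge0.
  by move=> i _; rewrite mxE mulr0.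
have [->|x0] := eqVneq x 0.
  rewrite /dotp big1; first by rewrite mulr_ge0// enorm_ge0.
  by move=> i _; rewrite mxE mul0r.
have := dotp_ge0 (enorm y *: x - enorm x *: y).
rewrite !(dotpBl, dotpBr, dotpZl) !(dotpC _ (_ *: _)) !dotpZl (dotpC y x).
have -> : dotp x x = enorm x ^+ 2 by rewrite sqr_sqrtr// dotp_ge0.
have -> : dotp y y = enorm y ^+ 2 by rewrite sqr_sqrtr// dotp_ge0.
move: y0 x0; rewrite -!enorm_gt0 => y0 x0 H.
have : 0 <= enorm x * enorm y * (enorm x * enorm y - dotp x y) by nra.
by rewrite pmulr_rge0 ?mulr_gt0// subr_ge0.
Qed.

Lemma enormD x y : enorm (x + y) <= enorm x + enorm y.
Proof.
rewrite -(ler_pXn2r (n := 2)) ?nnegrE ?addr_ge0 ?enorm_ge0//.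
have -> : enorm (x + y) ^+ 2 = enorm x ^+ 2 + enorm y ^+ 2 + 2 * dotp x y.
  rewrite !sqr_enorm /dotp mulr_sumr -!big_split/=.
  by apply: eq_bigr => i _; rewrite mxE; ring.
rewrite sqrrD; have := dotp_le x y; rewrite -mulr_natl; lra.
Qed.

Lemma enormN x : enorm (- x) = enorm x.
Proof. by rewrite -scaleN1r enormZ normrN1 mul1r. Qed.

(** The half-side r / n keeps square roots out of the constants: n (r / n)^2 = r^2 / n <= r^2. *)
Lemma enorm_lt_box x r : (0 < n)%N -> 0 < r ->
  (forall i, `|x ord0 i| < r / n%:R) -> enorm x < r.
Proof.
move=> n0 r0 xr.
rewrite -(ltr_pXn2r (n := 2)) ?nnegrE ?enorm_ge0 ?(ltW r0)//.
have nR : 0 < n%:R :> R by rewrite ltr0n.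
apply: (@lt_le_trans _ _ (\sum_(i < n) (r / n%:R) ^+ 2)).
  rewrite sqr_enorm.
  have xr2 i : x ord0 i ^+ 2 < (r / n%:R) ^+ 2.
    rewrite -real_normK ?num_real// ltr_pXn2r// nnegrE//.
    by apply: divr_ge0; exact: ltW.
  rewrite (bigD1 (Ordinal n0))//= [ltRHS](bigD1 (Ordinal n0))//=.
  by apply: ltr_leD => //; apply: ler_sum => i _; exact: ltW.
rewrite sumr_const card_ord -[leLHS]mulr_natl exprMn mulrCA -[leRHS]mulr1.
rewrite ler_wpM2l ?sqr_ge0// expr2 mulrA divff ?gt_eqF// mul1r.
by rewrite invf_le1// ler1n.
Qed.

End dotp_enorm.

Lemma measurable_EFin_lebesgue (R : realType) (f : R -> R) :
  measurable_fun [set: R] f ->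
  measurable_fun [set: measurableTypeR R] (fun x => (f x)%:E).
Proof.
by move=> mf; have h : measurable_fun [set: R] (EFin \o f) by apply/measurable_EFinP.
Qed.

Section lebesgue_rV_fubini.
Context (R : realType).
Notation mu := lebesgue_measure.

Lemma ge0_integral_rV_succ n (f : 'rV[R]_n.+1 -> \bar R) :
  measurable_fun setT f -> (forall x, 0 <= f x)%E ->
  (\int[lebesgue_rV]_x f x = \int[mu]_a \int[lebesgue_rV]_v f (rV_cons (a, v)))%E.
Proof.
move=> mf f0; rewrite /lebesgue_rV/= /lebesgue_rV_succ.
rewrite ge0_integral_pushforward//; last exact: measurable_rV_cons.
rewrite preimage_setT fubini_tonelli1//.
  by apply: measurableT_comp => //; exact: measurable_rV_cons.
by move=> x; exact: f0.
Qed.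

Lemma integral_rV_succ n (f : 'rV[R]_n.+1 -> \bar R) :
  lebesgue_rV.-integrable setT f ->
  (\int[lebesgue_rV]_x f x = \int[mu]_a \int[lebesgue_rV]_v f (rV_cons (a, v)))%E.
Proof.
move=> intf; have mf := measurable_int _ intf.
have mc := @measurable_rV_cons R n.
have i2 : (mu \x lebesgue_rV)%E.-integrable setT (f \o @rV_cons R n).
  apply/integrableP; split; first exact: measurableT_comp.
  have /integrableP[_] := intf.
  rewrite [X in (X < _)%E -> _](_ : _ = \int[(mu \x lebesgue_rV)%E]_x `|(f \o @rV_cons R n) x|)%E//.
  rewrite /lebesgue_rV/= /lebesgue_rV_succ ge0_integral_pushforward//; last exact: measurableT_comp.
rewrite /lebesgue_rV/= /lebesgue_rV_succ integral_pushforward//.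
by rewrite preimage_setT -integral12_prod_meas1.
Qed.

Lemma big_rV_cons n (F : 'I_n.+1 -> R -> R) a (v : 'rV[R]_n) :
  \prod_i F i (rV_cons (a, v) ord0 i) =
  F ord0 a * \prod_i F (lift ord0 i) (v ord0 i).
Proof.
rewrite big_ord_recl /rV_cons; congr (_ * _); first by rewrite mxE unlift_none.
by apply: eq_bigr => i _; rewrite mxE liftK.
Qed.

Lemma measurable_prod_coord n (f : 'I_n -> R -> R) :
  (forall i, measurable_fun setT (f i)) ->
  measurable_fun setT (fun x : 'rV[R]_n => \prod_i f i (x ord0 i)).
Proof.
move=> mf; apply: measurable_prod => i _.
exact: measurableT_comp (mf i) (measurable_rV_coord i).
Qed.

(** Tonelli in all coordinates at once, by induction on the dimension. Gaussians, cubes and power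
    weights are all integrated through it. In dimension 0 the measure is a unit mass, matching the
    empty product. *)
Lemma integral_prod_coord n (f : 'I_n -> R -> R) (c : 'I_n -> R) :
  (forall i, measurable_fun setT (f i)) -> (forall i x, 0 <= f i x) ->
  (forall i, (\int[mu]_x (f i x)%:E = (c i)%:E)%E) ->
  (\int[lebesgue_rV]_x (\prod_i f i ((x : 'rV[R]_n) ord0 i))%:E = (\prod_i c i)%:E)%E.
Proof.
elim: n f c => [|n IH] f c mf f0 fc.
  under eq_integral do rewrite big_ord0.
  by rewrite big_ord0 /lebesgue_rV/= integral_dirac// diracE in_setT mul1e.
rewrite ge0_integral_rV_succ; last 2 first.
- by apply/measurable_EFinP; exact: measurable_prod_coord.
- by move=> x; rewrite lee_fin; apply: prodr_ge0.
transitivity (\int[mu]_a ((f ord0 a)%:E * (\prod_i c (lift ord0 i))%:E))%E.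
  apply: eq_integral => a _; under eq_integral do rewrite big_rV_cons EFinM.
  rewrite ge0_integralZl//.
  - by rewrite (IH (fun i => f (lift ord0 i)) (fun i => c (lift ord0 i))).
  - by apply/measurable_EFinP; apply: (measurable_prod_coord (f := fun i => f (lift ord0 i))).
  - by move=> v _; rewrite lee_fin; apply: prodr_ge0.
  - by rewrite lee_fin.
rewrite ge0_integralZr//.
- by rewrite fc -EFinM big_ord_recl.
- exact: measurable_EFin_lebesgue (mf ord0).
- by move=> x _; rewrite lee_fin; exact: f0.
- rewrite lee_fin; apply: prodr_ge0 => i _; rewrite -lee_fin -fc.
  by apply: integral_ge0 => x _; rewrite lee_fin.
Qed.

End lebesgue_rV_fubini.

(** * Gaussian integrals *)

Section gaussian_1d.
Context (R : realType).
Notation mu := (@lebesgue_measure R).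

Definition gaussian (c a x : R) : R := expR (- (c * (x - a) ^+ 2)).

Lemma gaussian_gt0 c a x : 0 < gaussian c a x.
Proof. exact: expR_gt0. Qed.

Lemma gaussian_ge0 c a x : 0 <= gaussian c a x.
Proof. exact: expR_ge0. Qed.

Lemma continuous_gaussian c a : continuous (gaussian c a).
Proof.
move=> x; apply: continuous_comp; last exact: continuous_expR.
apply: continuousN; apply: continuousM; first exact: cvg_cst.
apply: (@continuous_comp _ _ _ (fun x => x - a) (fun x => x ^+ 2)).
  by apply: continuousB => //; exact: cvg_cst.
exact: exprn_continuous.
Qed.

Lemma measurable_gaussian c a : measurable_fun setT (gaussian c a).
Proof. by apply: continuous_measurable_fun; exact: continuous_gaussian. Qed.

Lemma integral_gaussian c a : 0 < c ->
  (\int[mu]_x (gaussian c a x)%:E = (Num.sqrt (pi / c))%:E)%E.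
Proof.
(* The standard deviation with 1 / (2 s^2) = c; the normal density then has total mass 1 and is a
   multiple of [gaussian c a]. *)
move=> c0; set s := (Num.sqrt (2 * c))^-1.
have c20 : 0 < 2 * c by rewrite mulr_gt0.
have s0 : s != 0 by rewrite invr_eq0 gt_eqF// sqrtr_gt0.
have s2 : s ^+ 2 = (2 * c)^-1 by rewrite exprVn sqr_sqrtr// ltW.
have := integral_normal_pdf a s; rewrite normal_pdfE//.
have pE x : normal_peak s * normal_fun a s x = (Num.sqrt (pi / c))^-1 * gaussian c a x.
  rewrite /normal_peak /normal_fun /gaussian s2; congr ((Num.sqrt _)^-1 * expR _).
    by rewrite -mulr_natl; field; rewrite gt_eqF.
  by rewrite -mulr_natl; field; rewrite gt_eqF.
under eq_integral do rewrite pE EFinM.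
have q0 : 0 < Num.sqrt (pi / c) by rewrite sqrtr_gt0 divr_gt0// pi_gt0.
rewrite ge0_integralZl//.
- move=> /(congr1 (fun z => (Num.sqrt (pi / c))%:E * z)%E).
  by rewrite muleA -EFinM divff ?gt_eqF// mul1e mule1.
- exact: measurable_EFin_lebesgue (measurable_gaussian _ _).
- by move=> x _; rewrite lee_fin gaussian_ge0.
Qed.

Lemma integrable_gaussian c a : 0 < c ->
  mu.-integrable setT (fun x => (gaussian c a x)%:E).
Proof.
move=> c0; apply/integrableP; split.
  exact: measurable_EFin_lebesgue (measurable_gaussian _ _).
under eq_integral do rewrite gee0_abs ?lee_fin ?gaussian_ge0//.
by rewrite integral_gaussian// ltry.
Qed.

(** Half of the exponent is spent on the factor |u|, u = x - a: the other half satisfies e^{c u^2 /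
    2} >= 1 + c u^2 / 2, and (1 + 2 / c)(1 + c u^2 / 2) contains 1 + u^2 >= |u|. The result
    dominates frequency derivatives and gives decay at infinity. *)
Lemma normr_gaussian_le c a x : 0 < c ->
  `|x - a| * gaussian c a x <= (1 + 2 / c) * gaussian (c / 2) a x.
Proof.
move=> c0; set u := x - a; rewrite /gaussian -/u.
have -> : c * u ^+ 2 = c / 2 * u ^+ 2 + c / 2 * u ^+ 2 by field.
rewrite opprD expRD mulrA ler_wpM2r ?expR_ge0//.
have : 1 + c / 2 * u ^+ 2 <= expR (c / 2 * u ^+ 2) by apply: expR_ge1Dx.
rewrite expRN ler_pdivrMr ?expR_gt0// => H.
apply: (@le_trans _ _ ((1 + 2 / c) * (1 + c / 2 * u ^+ 2))); last first.
  by rewrite ler_wpM2l// addr_ge0// divr_ge0// ltW.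
have -> : (1 + 2 / c) * (1 + c / 2 * u ^+ 2) = 1 + 2 / c + c / 2 * u ^+ 2 + u ^+ 2.
  by field; rewrite gt_eqF.
rewrite -(@real_normK _ u) ?num_real//; have := normr_ge0 u; set v := `|u| => v0.
have : 0 <= 2 / c by rewrite divr_ge0// ltW.
have : 0 <= c / 2 * v ^+ 2 by rewrite mulr_ge0 ?divr_ge0 ?sqr_ge0// ltW.
nra.
Qed.

(** The fundamental theorem on growing symmetric intervals, combined with dominated convergence. It
    supplies the vanishing boundary terms of the integration by parts. *)
Lemma integral_derivative0 (F f : R -> R) :
  (forall x : R, is_derive x (1 : R) F (f x)) -> continuous f ->
  mu.-integrable setT (EFin \o f) ->
  (F n%:R @[n --> \oo] --> 0) -> (F (- n%:R) @[n --> \oo] --> 0) ->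
  (\int[mu]_x (f x)%:E = 0)%E.
Proof.
move=> dF cf intf Fy FNy.
have dF1 (x : R) : derivable F x 1 by have [] := dF x.
have cF : continuous F.
  by move=> x; apply: differentiable_continuous; exact/derivable1_diffP.
(* The successor keeps the interval nondegenerate for n = 0, as the fundamental theorem requires. *)
pose I (n : nat) : set R := [set` `[- n.+1%:R, n.+1%:R]%R].
have FTC n : (\int[mu]_(x in I n) (f x)%:E = (F n.+1%:R)%:E - (F (- n.+1%:R))%:E)%E.
  rewrite /I (continuous_FTC2 (F := F))//.
  - by have : 0 < n.+1%:R :> R; [rewrite ltr0n|lra].
  - exact: continuous_subspaceT.
  - split.
    + by move=> x _; exact: dF1.
    + by apply: cvg_at_right_filter; exact: cF.
    + by apply: cvg_at_left_filter; exact: cF.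
  - by move=> x _; rewrite derive1E; have [_ ->] := dF x.
have h1 : (\int[mu]_x ((EFin \o f) \_ (I n)) x @[n --> \oo] --> \int[mu]_x (f x)%:E)%E.
  apply: (@dominated_cvg _ _ _ mu setT measurableT _ (EFin \o f) (fun x => `|(f x)%:E|%E)) => //.
  - move=> n; apply/(measurable_restrictT _ _).1.
      exact: measurable_itv.
    by apply: measurable_funTS; apply/measurable_EFinP; exact: continuous_measurable_fun.
  - move=> x _; apply: cvg_near_cst; near=> n.
    rewrite patchE ifT// inE /I /= in_itv/=.
    have : `|x| <= n.+1%:R.
      near: n; exists (Num.trunc `|x|) => // n /= xn.
      apply: ltW; apply: lt_le_trans (truncnS_gt _) _.
      by rewrite ler_nat.
    by rewrite ler_norml.
  - by move: intf => /integrable_abse.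
  - move=> n x _; rewrite patchE; case: ifP => // _; rewrite abse0; exact: abse_ge0.
have h2 : (F n.+1%:R - F (- n.+1%:R))%:E @[n --> \oo] --> ((0 - 0 : R)%:E).
  apply: cvg_EFin; first exact: nearW.
  apply: cvgB.
    by move: Fy; rewrite -(cvg_shiftS (fun n => F n%:R)).
  by move: FNy; rewrite -(cvg_shiftS (fun n => F (- n%:R))).
have E n : (\int[mu]_x ((EFin \o f) \_ (I n)) x = (F n.+1%:R - F (- n.+1%:R))%:E)%E.
  by rewrite -integral_mkcond FTC.
rewrite subr0 in h2; rewrite (funext E) in h1.
exact: cvg_unique h1 h2.
Unshelve. all: end_near. Qed.

End gaussian_1d.

Section gaussian_fourier_1d.
Context (R : realType).
Notation mu := (@lebesgue_measure R).

Lemma is_derive_gaussian c a (x : R) :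
  is_derive x (1 : R) (gaussian c a) (- (2 * c * (x - a)) * gaussian c a x).
Proof.
have d1 : is_derive x (1 : R) (fun y : R => - (c * (y - a) ^+ 2)) (- (2 * c * (x - a))).
  apply: is_derive_eq; rewrite /GRing.scale/= ; ring.
have := is_derive1_comp (is_derive_expR _) d1.
by rewrite /comp mulrC.
Qed.

Lemma is_derive_affine (z a p : R) (x : R) : is_derive x (1 : R) (fun y : R => z * (y - a) + p) z.
Proof. by apply: is_derive_eq; rewrite /GRing.scale/=; ring. Qed.

Lemma integrable_bounded_dominated (f G : R -> R) :
  mu.-integrable setT (EFin \o G) -> measurable_fun setT f ->
  (forall x, `|f x| <= G x) -> mu.-integrable setT (EFin \o f).
Proof.
move=> iG mf fG; apply: (le_integrable measurableT _ _ iG).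
  exact: measurable_EFin_lebesgue.
by move=> x _ /=; rewrite lee_fin (le_trans (fG x))// ler_norm.
Qed.

Lemma measurable_cos_affine (z a p : R) : measurable_fun setT (fun x : R => cos (z * (x - a) + p)).
Proof.
apply: continuous_measurable_fun => x; apply: continuous_comp; last exact: continuous_cos.
by apply: differentiable_continuous; apply/derivable1_diffP; have [] := is_derive_affine z a p x.
Qed.

Variables (c a : R).
Hypothesis c0 : 0 < c.

Let W p z x := gaussian c a x * cos (z * (x - a) + p).

Let mW p z : measurable_fun setT (W p z).
Proof. by apply: measurable_funM; [exact: measurable_gaussian|exact: measurable_cos_affine]. Qed.

Lemma integrable_gaussian_cos p z : mu.-integrable setT (EFin \o W p z).
Proof.
apply: (integrable_bounded_dominated (integrable_gaussian a c0)) => // x.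
by rewrite /W normrM ger0_norm ?gaussian_ge0// ler_piMr ?gaussian_ge0 ?cos_max.
Qed.

(** Minus the derivative of [W] in the frequency [z]. Differentiating the Gaussian in x brings out
    the same factor x - a, and this coincidence closes the differential equation for the
    integral. *)
Let V p z x := (x - a) * (gaussian c a x * sin (z * (x - a) + p)).

Let iG : mu.-integrable setT (EFin \o (fun x => (1 + 2 / c) * gaussian (c / 2) a x)).
Proof.
rewrite (_ : EFin \o _ = fun x => ((1 + 2 / c)%:E * (gaussian (c / 2) a x)%:E)%E).
  by apply: integrableZl => //; apply: integrable_gaussian; rewrite divr_gt0.
by apply/funext => x /=; rewrite EFinM.
Qed.

Let sinE (x : R) : sin x = - cos (x + pi / 2).
Proof. by rewrite cosDpihalf opprK. Qed.

Let mV p z : measurable_fun setT (V p z).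
Proof.
apply: measurable_funM.
  by apply: measurable_funB.
apply: measurable_funM; first exact: measurable_gaussian.
under eq_fun do rewrite sinE -addrA.
by apply: measurableT_comp => //; exact: measurable_cos_affine.
Qed.

Let VG p z x : `|V p z x| <= (1 + 2 / c) * gaussian (c / 2) a x.
Proof.
apply: le_trans (normr_gaussian_le a x c0).
rewrite /V !normrM ler_wpM2l// ger0_norm ?gaussian_ge0//.
by rewrite ler_piMr ?gaussian_ge0 ?sin_max.
Qed.

Let iV p z : mu.-integrable setT (EFin \o V p z).
Proof. exact: (integrable_bounded_dominated iG). Qed.

Let dW p z (x : R) : is_derive z (1 : R) (W p ^~ x) (- V p z x).
Proof.
have d1 : is_derive z (1 : R) (fun y : R => y * (x - a) + p) (x - a).
  by apply: is_derive_eq; rewrite /GRing.scale/=; ring.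
have d2 := is_derive1_comp (is_derive_cos _) d1.
apply: is_derive_eq; rewrite /GRing.scale/= /V; ring.
Qed.

Let Psi p z := \int[mu]_x W p z x.
Let S p z := \int[mu]_x V p z x.

Let dPsi p z : is_derive z (1 : R) (Psi p) (- S p z).
Proof.
have Iz : [set` `]z - 1, z + 1[] z by rewrite /= in_itv/=; apply/andP; split; lra.
have iW (x : R) : [set` `]z - 1, z + 1[] x -> mu.-integrable setT (EFin \o W p x).
  by move=> _; exact: integrable_gaussian_cos.
have dW1 (x y : R) : [set` `]z - 1, z + 1[] x -> setT y -> derivable (W p ^~ y) x 1.
  by move=> _ _; have [] := dW p x y.
have G0 y : 0 <= (1 + 2 / c) * gaussian (c / 2) a y.
  by rewrite mulr_ge0 ?gaussian_ge0// addr_ge0// divr_ge0// ltW.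
have Gub (x y : R) : [set` `]z - 1, z + 1[] x -> setT y ->
    `|partial1of2 (W p) x y| <= (1 + 2 / c) * gaussian (c / 2) a y.
  by move=> _ _; rewrite partial1of2E; have [_ ->] := dW p x y; rewrite normrN; exact: VG.
apply: DeriveDef.
  exact: (derivable_under_integral measurableT Iz iW dW1 G0 iG Gub).
rewrite -derive1E (differentiation_under_integral measurableT Iz iW dW1 G0 iG Gub).
rewrite /S -mulN1r -RintegralZl//.
by apply: eq_Rintegral => x _; rewrite mulN1r partial1of2E; have [_ ->] := dW p z x.
Qed.

Let cvg_gaussian_nat (e : nat -> R) (F : R -> R) :
  (forall x, `|F x| <= gaussian c a x) ->
  (forall n : nat, n%:R <= `|e n - a| + `|a|) -> F (e n) @[n --> \oo] --> 0.
Proof.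
move=> FG en; apply: norm_cvg0.
(* From n + 1 <= |e n - a| + |a| + 1: times the Gaussian, the three terms are at most 1 + 2 / c, |a|
   and 1. Hence F (e n) = O(1 / (n + 1)). *)
set K := 1 + 2 / c + `|a| + 1.
have h : K * harmonic n @[n --> \oo] --> 0.
  rewrite -[X in _ --> X](mulr0 K).
  by apply: cvgM; [exact: cvg_cst|exact: cvg_harmonic].
have g1 c' x : 0 < c' -> gaussian c' a x <= 1.
  by move=> c'0; rewrite -expR0 ler_expR oppr_le0 mulr_ge0 ?sqr_ge0// ltW.
apply: (squeeze_cvgr _ (cvg_cst 0) h); near=> n.
rewrite normr_ge0/= (le_trans (FG _))// /harmonic/= ler_pdivlMr ?ltr0n//.
have := normr_gaussian_le a (e n) c0.
have g2 := g1 _ (e n) c0.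
have g3 : (1 + 2 / c) * gaussian (c / 2) a (e n) <= 1 + 2 / c.
  by rewrite ler_piMr ?addr_ge0 ?divr_ge0 ?(ltW c0)// g1// divr_gt0.
move=> /le_trans/(_ g3) H; rewrite /K -natr1 mulrDr mulr1 lerD//.
have := en n; have := gaussian_ge0 c a (e n); have := normr_ge0 a.
set u := `|e n - a| in H *; nra.
Unshelve. all: end_near. Qed.

(** Gaussian times sine vanishes at both ends, and its derivative is - 2 c V + z W, whose integral
    is therefore 0. *)
Let IBP p z : 2 * c * S p z = z * Psi p z.
Proof.
pose F x := gaussian c a x * sin (z * (x - a) + p).
pose f x := - (2 * c) * V p z x + z * W p z x.
have dF (x : R) : is_derive x (1 : R) F (f x).
  have d1 := is_derive_gaussian c a x.
  have d2 := is_derive1_comp (is_derive_sin _) (is_derive_affine z a p x).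
  apply: is_derive_eq; rewrite /GRing.scale/= /f /V /W; ring.
have FG x : `|F x| <= gaussian c a x.
  by rewrite /F normrM ger0_norm ?gaussian_ge0// ler_piMr ?gaussian_ge0 ?sin_max.
have cf : continuous f.
  have cg := @continuous_gaussian R c a.
  have ca : continuous (fun x : R => z * (x - a) + p).
    by move=> x; apply: differentiable_continuous; apply/derivable1_diffP; have [] := is_derive_affine z a p x.
  have cs : continuous (fun x : R => sin (z * (x - a) + p)).
    by move=> x; apply: continuous_comp; [exact: ca|exact: continuous_sin].
  have cc : continuous (fun x : R => cos (z * (x - a) + p)).
    by move=> x; apply: continuous_comp; [exact: ca|exact: continuous_cos].
  have cm : continuous (fun x : R => x - a).
    by move=> x; apply: continuousB => //; exact: cvg_cst.
  move=> x; apply: cvgD; (apply: cvgM; first exact: cvg_cst).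
    by apply: cvgM; [exact: cm|apply: cvgM; [exact: cg|exact: cs]].
  by apply: cvgM; [exact: cg|exact: cc].
have iVW1 : mu.-integrable setT (fun x => ((- (2 * c))%:E * (V p z x)%:E)%E).
  by apply: integrableZl => //; exact: iV.
have iVW2 : mu.-integrable setT (fun x => (z%:E * (W p z x)%:E)%E).
  by apply: integrableZl => //; exact: integrable_gaussian_cos.
have fE : EFin \o f = (fun x => (- (2 * c))%:E * (V p z x)%:E + z%:E * (W p z x)%:E)%E by [].
have := integral_derivative0 dF cf.
rewrite fE => /(_ (integrableD measurableT iVW1 iVW2)).
have e1 : F n%:R @[n --> \oo] --> 0.
  apply: (@cvg_gaussian_nat (fun n => n%:R)) => // n.
  by rewrite -[leLHS](subrK a) (le_trans (ler_norm _))// ler_normD.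
have e2 : F (- n%:R) @[n --> \oo] --> 0.
  apply: (@cvg_gaussian_nat (fun n => - n%:R)) => // n.
  have := ler_normB (- n%:R - a) (- a); rewrite opprK subrK normrN normrN => h.
  by apply: le_trans h; exact: ler_norm.
move=> /(_ e1 e2).
rewrite [X in X = _ -> _](_ : _ = (\int[mu]_x ((- (2 * c))%:E * (V p z x)%:E + z%:E * (W p z x)%:E))%E)//.
rewrite (integralD measurableT iVW1 iVW2) (integralZl measurableT (iV p z)).
rewrite (integralZl measurableT (integrable_gaussian_cos p z)).
rewrite -(fineK (integrable_fin_num measurableT (iV p z))).
rewrite -(fineK (integrable_fin_num measurableT (integrable_gaussian_cos p z))).
rewrite -!EFinM -EFinD => -[h].
have {}h : - (2 * c) * S p z + z * Psi p z = 0 by exact: h.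
lra.
Qed.

(* As a function of z, the integral solves Psi' = - z / (2 c) * Psi: differentiate
   under the integral sign, then integrate by parts. *)
Lemma integral_gaussian_cos p z :
  \int[mu]_x (gaussian c a x * cos (z * (x - a) + p)) =
  cos p * Num.sqrt (pi / c) * expR (- (z ^+ 2 / (4 * c))).
Proof.
(* [Psi] times the integrating factor of the equation; its derivative is 0, so its value at [z] is
   the one at 0. *)
pose H y := Psi p y * expR (y ^+ 2 / (4 * c)).
have dH (y : R) : is_derive y (1 : R) H 0.
  have d1 : is_derive y (1 : R) (fun y : R => y ^+ 2 / (4 * c)) (y / (2 * c)).
    apply: is_derive_eq; rewrite /GRing.scale/=; field; by rewrite gt_eqF.
  have d2 := is_derive1_comp (is_derive_expR _) d1.
  have d3 := dPsi p y.
  have SE : S p y = y * Psi p y / (2 * c).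
    by rewrite -IBP; field; rewrite gt_eqF.
  apply: is_derive_eq; rewrite /GRing.scale/= SE /comp; ring.
have := is_derive_0_is_cst z 0 dH.
rewrite /H expr0n/= mul0r expR0 mulr1 => h.
have P0 : Psi p 0 = cos p * Num.sqrt (pi / c).
  rewrite /Psi; transitivity (\int[mu]_x (cos p * gaussian c a x)).
    by apply: eq_Rintegral => x _; rewrite /W mul0r add0r mulrC.
  rewrite RintegralZl//; last exact: integrable_gaussian.
  by rewrite /Rintegral integral_gaussian.
by rewrite -P0 -h expRN mulfK ?gt_eqF ?expR_gt0.
Qed.

End gaussian_fourier_1d.

Section gaussian_fourier_rV.
Context (R : realType).
Notation mu := (@lebesgue_measure R).

Definition gaussian_rV n (c : R) (x y : 'rV[R]_n) : R :=
  expR (- (c * enorm (y - x) ^+ 2)).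

Lemma gaussian_rVE n c (x y : 'rV[R]_n) :
  gaussian_rV c x y = \prod_i gaussian c (x ord0 i) (y ord0 i).
Proof.
rewrite /gaussian_rV sqr_enorm mulr_sumr -sumrN expR_sum.
by apply: eq_bigr => i _; rewrite !mxE.
Qed.

Lemma gaussian_rV_ge0 n c (x y : 'rV[R]_n) : 0 <= gaussian_rV c x y.
Proof. exact: expR_ge0. Qed.

Lemma gaussian_rV_le1 n c (x y : 'rV[R]_n) : 0 <= c -> gaussian_rV c x y <= 1.
Proof. by move=> c0; rewrite -expR0 ler_expR oppr_le0 mulr_ge0// sqr_ge0. Qed.

Lemma measurable_gaussian_rV d (T : measurableType d) n c (f g : T -> 'rV[R]_n) :
  measurable_fun setT f -> measurable_fun setT g ->
  measurable_fun setT (fun t => gaussian_rV c (f t) (g t)).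
Proof.
move=> mf mg; rewrite /gaussian_rV; under eq_fun do rewrite -mulNr.
apply: (measurableT_comp (f := @expR R)) => //.
apply: measurable_funM => //; apply: measurable_funX.
by apply: measurable_enorm; exact: measurable_rVB.
Qed.

Lemma measurable_cos_dotp d (T : measurableType d) n (p : R) (f g : T -> 'rV[R]_n) :
  measurable_fun setT f -> measurable_fun setT g ->
  measurable_fun setT (fun t => cos (dotp (f t) (g t) + p)).
Proof.
move=> mf mg; apply: (measurableT_comp (f := @cos R)).
  by apply: continuous_measurable_fun; exact: continuous_cos.
by apply: measurable_funD => //; exact: measurable_dotp.
Qed.

Lemma integral_gaussian_rV n c (x : 'rV[R]_n) : 0 < c ->
  (\int[lebesgue_rV]_y (gaussian_rV c x y)%:E = (Num.sqrt (pi / c) ^+ n)%:E)%E.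
Proof.
move=> c0; under eq_integral do rewrite gaussian_rVE.
rewrite (integral_prod_coord (f := fun i => gaussian c (x ord0 i)) (c := fun=> Num.sqrt (pi / c))).
- by rewrite prodr_const card_ord.
- by move=> i; exact: measurable_gaussian.
- by move=> i y; exact: gaussian_ge0.
- by move=> i; exact: integral_gaussian.
Qed.

Lemma integrable_gaussian_rV n c (x : 'rV[R]_n) : 0 < c ->
  lebesgue_rV.-integrable setT (fun y => (gaussian_rV c x y)%:E).
Proof.
move=> c0; apply/integrableP; split.
  by apply/measurable_EFinP; apply: measurable_gaussian_rV.
under eq_integral do rewrite gee0_abs ?lee_fin ?gaussian_rV_ge0//.
by rewrite integral_gaussian_rV// ltry.
Qed.

Lemma integrable_gaussian_rV_cos n c (x z : 'rV[R]_n) p : 0 < c ->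
  lebesgue_rV.-integrable setT (fun y => (gaussian_rV c x y * cos (dotp z y + p))%:E).
Proof.
move=> c0; apply: (le_integrable measurableT _ _ (integrable_gaussian_rV x c0)).
  apply/measurable_EFinP; apply: measurable_funM; first exact: measurable_gaussian_rV.
  exact: measurable_cos_dotp.
move=> y _ /=; rewrite lee_fin normrM ler_piMr ?normr_ge0//.
exact: cos_max.
Qed.

Lemma dotp_cons n (z : 'rV[R]_n.+1) a v :
  dotp z (rV_cons (a, v)) = z ord0 ord0 * a + dotp (rV_uncons z).2 v.
Proof.
rewrite /dotp big_ord_recl /rV_cons; congr (_ + _); first by rewrite mxE unlift_none.
by apply: eq_bigr => i _; rewrite !mxE liftK.
Qed.

Lemma dotp_uncons n (z x : 'rV[R]_n.+1) :
  dotp z x = z ord0 ord0 * x ord0 ord0 + dotp (rV_uncons z).2 (rV_uncons x).2.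
Proof. by rewrite -[in LHS](rV_unconsK x) dotp_cons. Qed.

Lemma gaussian_rV_cons n c (x : 'rV[R]_n.+1) a v :
  gaussian_rV c x (rV_cons (a, v)) =
  gaussian c (x ord0 ord0) a * gaussian_rV c (rV_uncons x).2 v.
Proof.
rewrite !gaussian_rVE (big_rV_cons (fun i => gaussian c (x ord0 i))).
by congr (_ * _); apply: eq_bigr => i _; rewrite !mxE.
Qed.

(* The phase p makes the induction on the dimension go through: the integral
   over the last coordinates has the phase z_0 y_0 + p. *)
Lemma integral_gaussian_rV_cos n c (x z : 'rV[R]_n) p : 0 < c ->
  (\int[lebesgue_rV]_y (gaussian_rV c x y * cos (dotp z y + p))%:E =
  (cos (dotp z x + p) * (Num.sqrt (pi / c) ^+ n * gaussian_rV (4 * c)^-1 0 z))%:E)%E.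
Proof.
move=> c0; elim: n x z p => [|n IH] x z p.
  rewrite /lebesgue_rV/= integral_dirac//; last first.
    apply/measurable_EFinP; apply: measurable_funM; first exact: measurable_gaussian_rV.
    exact: measurable_cos_dotp.
  rewrite diracE in_setT mul1e !gaussian_rVE !big_ord0 expr0 !mul1r mulr1.
  by rewrite /dotp !big_ord0.
rewrite integral_rV_succ; last exact: integrable_gaussian_rV_cos.
set q := fun a => cos (z ord0 ord0 * (a - x ord0 ord0) + (dotp z x + p)).
set K := Num.sqrt (pi / c) ^+ n * gaussian_rV (4 * c)^-1 0 (rV_uncons z).2.
transitivity (\int[mu]_a (K%:E * (gaussian c (x ord0 ord0) a * q a)%:E))%E.
  apply: eq_integral => a _.
  transitivity (\int[lebesgue_rV]_v ((gaussian c (x ord0 ord0) a)%:E *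
     (gaussian_rV c (rV_uncons x).2 v *
       cos (dotp (rV_uncons z).2 v + (z ord0 ord0 * a + p)))%:E))%E.
    apply: eq_integral => v _; rewrite -EFinM gaussian_rV_cons dotp_cons -mulrA.
    by congr (_ * (_ * cos _))%:E; ring.
  rewrite integralZl//; last exact: integrable_gaussian_rV_cos.
  rewrite IH -!EFinM /q /K (dotp_uncons z x); congr EFin.
  rewrite [in RHS]mulrC -!mulrA; congr (_ * (cos _ * _)); ring.
rewrite integralZl//; last exact: integrable_gaussian_cos.
have := integral_gaussian_cos (x ord0 ord0) c0 (dotp z x + p) (z ord0 ord0).
rewrite /Rintegral => h.
rewrite -(fineK (integrable_fin_num measurableT (integrable_gaussian_cos (x ord0 ord0) c0 (dotp z x + p) (z ord0 ord0)))).
rewrite [X in (_ * X%:E)%E]h -EFinM; congr EFin.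
rewrite /K !gaussian_rVE big_ord_recl /gaussian !mxE subr0 [(4 * c)^-1 * _]mulrC.
set P := \prod_(i < n) _; set Q := \prod_(i < n) _.
have -> : P = Q by apply: eq_bigr => i _; rewrite !mxE.
by rewrite [in RHS]exprS; set e := expR _; set s := Num.sqrt _; rewrite mulrCA; ring.
Qed.

End gaussian_fourier_rV.

(** * Schwartz functions and the heat kernel *)

Section gaussian_waves.
Context (R : realType) (n : nat) (c : R) (x : 'rV[R]_n).

(** A class stable under partial derivatives, so that smoothness and decay of all derivatives follow
    by induction on the constructors. The free phase [p] makes sines instances of the base case. *)
Inductive gaussian_wave : ('rV[R]_n -> R) -> Prop :=
| wave_base p : gaussian_wave (fun y => gaussian_rV c 0 y * cos (dotp x y + p))
| wave_add u v : gaussian_wave u -> gaussian_wave v ->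
    gaussian_wave (fun y => u y + v y)
| wave_scale a u : gaussian_wave u -> gaussian_wave (fun y => a * u y)
| wave_coord j u : gaussian_wave u -> gaussian_wave (fun y => y ord0 j * u y).

(** Brings directional derivatives within reach of the one-variable derivative rules. *)
Lemma is_derive_line (f : 'rV[R]_n -> R) (y v : 'rV[R]_n) l :
  is_derive (0 : R) (1 : R) (fun t => f (t *: v + y)) l -> is_derive y v f l.
Proof.
move=> [df dv].
have E : (fun h : R => h^-1 *: (f (h *: v + y) - f y)) =
         (fun h : R => h^-1 *: (f ((h *: (1 : R) + 0) *: v + y) - f (0 *: v + y))).
  by apply/funext => h; rewrite scale0r add0r addr0 [h *: 1]mulr1.
apply: DeriveDef.
  by rewrite /derivable E; exact: df.
by rewrite -dv /derive E.
Qed.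

Lemma dotp_line (y v z : 'rV[R]_n) t : dotp z (t *: v + y) = t * dotp z v + dotp z y.
Proof.
rewrite /dotp mulr_sumr -big_split/=; apply: eq_bigr => i _.
by rewrite !mxE; ring.
Qed.

Lemma is_derive_coord (y v : 'rV[R]_n) j :
  is_derive y v (fun y : 'rV[R]_n => y ord0 j) (v ord0 j).
Proof.
apply: is_derive_line.
under eq_fun do rewrite !mxE.
by apply: is_derive_eq; rewrite /GRing.scale/=; ring.
Qed.

Lemma is_derive_wave_base p (y v : 'rV[R]_n) :
  is_derive y v (fun y => gaussian_rV c 0 y * cos (dotp x y + p))
   (- (2 * c) * (dotp y v * (gaussian_rV c 0 y * cos (dotp x y + p)))
    + dotp x v * (gaussian_rV c 0 y * cos (dotp x y + (p + pi / 2)))).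
Proof.
apply: is_derive_line.
have d1 : is_derive (0 : R) (1 : R) (fun t => - (c * enorm (t *: v + y - 0) ^+ 2))
    (- (2 * c * dotp y v)).
  have -> : (fun t => - (c * enorm (t *: v + y - 0) ^+ 2)) =
     (fun t => - (c * (dotp v v * t ^+ 2 + 2 * dotp y v * t + dotp y y))).
    apply/funext => t; rewrite subr0 sqr_sqrtr ?dotp_ge0//.
    rewrite dotp_line (dotpC (_ + _) v) (dotpC (_ + _) y) !dotp_line (dotpC v y).
    by congr (- (c * _)); ring.
  by apply: is_derive_eq; rewrite /GRing.scale/=; ring.
have d2 : is_derive (0 : R) (1 : R) (fun t => dotp x (t *: v + y) + p) (dotp x v).
  under eq_fun do rewrite dotp_line.
  by apply: is_derive_eq; rewrite /GRing.scale/=; ring.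
have d3 := is_derive1_comp (is_derive_expR _) d1.
have d4 := is_derive1_comp (is_derive_cos _) d2.
apply: is_derive_eq; rewrite !scale0r !add0r addrA cosDpihalf /GRing.scale/= /gaussian_rV.
by ring.
Qed.

(** Differentiating the Gaussian produces a coordinate factor and differentiating the cosine
    advances its phase by pi / 2; the constructors allow both. *)
Lemma wave_derive j u : gaussian_wave u -> exists2 u', gaussian_wave u' &
  forall y, is_derive y (delta_mx ord0 j) u (u' y).
Proof.
elim => [p|u1 v1 _ [u' wu' du'] _ [v' wv' dv']|a u1 _ [u' wu' du']|k u1 wu1 [u' wu' du']].
- exists (fun y : 'rV[R]_n => - (2 * c) * (y ord0 j * (gaussian_rV c 0 y * cos (dotp x y + p)))
    + x ord0 j * (gaussian_rV c 0 y * cos (dotp x y + (p + pi / 2)))).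
    by apply: wave_add; apply: wave_scale; [apply: wave_coord|]; exact: wave_base.
  have dotpd (z : 'rV[R]_n) : dotp z (delta_mx ord0 j) = z ord0 j.
    rewrite /dotp (bigD1 j)//= mxE !eqxx mulr1 big1 ?addr0// => i ij.
    by rewrite mxE (negbTE ij) andbF mulr0.
  by move=> y; have := is_derive_wave_base p y (delta_mx ord0 j); rewrite !dotpd.
- exists (fun y => u' y + v' y); first exact: wave_add.
  by move=> y; have h1 := du' y; have h2 := dv' y; apply: is_derive_eq.
- exists (fun y => a * u' y); first exact: wave_scale.
  by move=> y; have h1 := du' y; apply: is_deriveZ.
- exists (fun y : 'rV[R]_n => y ord0 k * u' y + (if k == j then 1 else 0) * u1 y).
    by apply: wave_add; [exact: wave_coord|exact: wave_scale].
  move=> y; have h1 := du' y; have h2 := is_derive_coord y (delta_mx ord0 j) k.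
  apply: is_derive_eq; rewrite /GRing.scale/= mxE eqxx /=.
  by case: eqP => _ /=; ring.
Qed.

Lemma wave_pderiv u s : gaussian_wave u -> gaussian_wave (pderiv s u).
Proof.
move=> wu; elim: s => //= j s IH.
have [u' wu' du'] := wave_derive j IH.
rewrite (_ : (fun y => _) = u')//; apply/funext => y.
by have [_ ->] := du' y.
Qed.

Lemma continuous_dotp (z : 'rV[R]_n) : continuous (dotp z).
Proof.
move=> y; rewrite /dotp.
apply: (@cvg_big _ _ +%R 0 xpredT _ _ (nbhs y) _ _ _ (nbhs_filter y)) => [p|i _].
  exact: add_continuous.
apply: cvgM; first exact: cvg_cst.
exact: coord_continuous.
Qed.

Lemma continuous_sqr_enorm : continuous (fun y : 'rV[R]_n => enorm y ^+ 2).
Proof.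
under eq_fun do rewrite sqr_enorm.
move=> y; apply: (@cvg_big _ _ +%R 0 xpredT _ _ (nbhs y) _ _ _ (nbhs_filter y)) => [p|i _].
  exact: add_continuous.
rewrite expr2; under eq_fun do rewrite expr2.
by apply: cvgM; exact: coord_continuous.
Qed.

Lemma wave_continuous u : gaussian_wave u -> continuous u.
Proof.
elim => [p|u1 v1 _ cu _ cv|a u1 _ cu|k u1 _ cu] y; have FF := nbhs_filter y.
- apply: cvgM.
    have h : continuous (fun y : 'rV[R]_n => - (c * enorm (y - 0) ^+ 2)).
      under eq_fun do rewrite subr0 -mulNr.
      move=> z; have FFz := nbhs_filter z.
      by apply: cvgM; [exact: cvg_cst|exact: continuous_sqr_enorm].
    exact: (continuous_comp (h y) (@continuous_expR R _)).
  have h : continuous (fun y => dotp x y + p).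
    move=> z; have FFz := nbhs_filter z.
    by apply: cvgD; [exact: continuous_dotp|exact: cvg_cst].
  exact: (continuous_comp (h y) (@continuous_cos R _)).
- by apply: cvgD; [exact: cu|exact: cv].
- by apply: cvgM; [exact: cvg_cst|exact: cu].
- by apply: cvgM; [exact: coord_continuous|exact: cu].
Qed.

Hypothesis c0 : 0 < c.

Lemma expR_ge_pow (s : R) N : 0 <= s -> (1 + s) ^+ N <= expR (N%:R * s).
Proof.
move=> s0; rewrite expRM_natl lerXn2r ?nnegrE ?expR_ge0 ?addr_ge0//.
exact: expR_ge1Dx.
Qed.

Lemma gaussian_rV_decay N : exists M, forall y : 'rV[R]_n,
  (1 + enorm y) ^+ N * gaussian_rV c 0 y <= M.
Proof.
(* Chosen so that 1 + r <= K (1 + s) with s = c r^2 / (N + 1). Then (1 + s)^N <= e^{N s} <= e^{c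
   r^2}. Dividing by N + 1 instead of N covers N = 0. *)
pose K := 2 + N.+1%:R / c.
have K0 : 0 < K by rewrite addr_gt0// divr_gt0// ltr0n.
exists (K ^+ N) => y; rewrite /gaussian_rV subr0 expRN ler_pdivrMr ?expR_gt0//.
set r := enorm y; have r0 : 0 <= r := enorm_ge0 y.
have N1 : 0 < N.+1%:R :> R by rewrite ltr0n.
have s0 : 0 <= c * r ^+ 2 / N.+1%:R.
  by rewrite divr_ge0 ?ler0n// mulr_ge0 ?sqr_ge0// ltW.
have rK : 1 + r <= K * (1 + c * r ^+ 2 / N.+1%:R).
  have -> : K * (1 + c * r ^+ 2 / N.+1%:R) =
      2 + r ^+ 2 + (N.+1%:R / c + 2 * (c * r ^+ 2 / N.+1%:R)).
    by rewrite /K; field; rewrite !gt_eqF.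
  have : 0 <= N.+1%:R / c + 2 * (c * r ^+ 2 / N.+1%:R).
    apply: addr_ge0; first by rewrite divr_ge0// ltW.
    by rewrite mulr_ge0.
  move: (N.+1%:R / c + _) => X X0; have := sqr_ge0 (r - 1); nra.
apply: (@le_trans _ _ (K ^+ N * (1 + c * r ^+ 2 / N.+1%:R) ^+ N)).
  by rewrite -exprMn lerXn2r// nnegrE ?addr_ge0// ltW// (lt_le_trans _ rK)// ltr_pwDl.
rewrite ler_wpM2l ?exprn_ge0 ?(ltW K0)//.
apply: le_trans (expR_ge_pow N s0) _; rewrite ler_expR.
rewrite mulrCA ler_piMr ?mulr_ge0 ?sqr_ge0 ?(ltW c0)//.
by rewrite ler_pdivrMr// mul1r ler_nat.
Qed.

Lemma wave_decay u N : gaussian_wave u ->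
  exists M, forall y, (1 + enorm y) ^+ N * `|u y| <= M.
Proof.
move=> wu; elim: wu N => [p|u1 v1 _ IHu _ IHv|a u1 _ IH|k u1 _ IH] N.
- have [M HM] := gaussian_rV_decay N; exists M => y.
  apply: le_trans (HM y); rewrite ler_wpM2l ?exprn_ge0 ?addr_ge0 ?enorm_ge0//.
  rewrite normrM ger0_norm ?gaussian_rV_ge0// ler_piMr ?gaussian_rV_ge0//.
  exact: cos_max.
- have [M1 HM1] := IHu N; have [M2 HM2] := IHv N; exists (M1 + M2) => y.
  apply: le_trans (lerD (HM1 y) (HM2 y)); rewrite -mulrDr.
  by rewrite ler_wpM2l ?exprn_ge0 ?addr_ge0 ?enorm_ge0// ler_normD.
- have [M HM] := IH N; exists (`|a| * M) => y.
  by rewrite normrM mulrCA ler_wpM2l.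
- have [M HM] := IH N.+1; exists M => y.
  apply: le_trans (HM y); rewrite normrM exprSr -mulrA.
  rewrite ler_wpM2l ?exprn_ge0 ?addr_ge0 ?enorm_ge0// ler_wpM2r//.
  by rewrite (le_trans (coord_le_enorm y k))// lerDr.
Qed.

(** The last direction of the list is the innermost derivative. Peeling it off leaves a shorter list
    applied to another wave, to which the induction hypothesis applies; summing over the finitely
    many directions makes [M] independent of the list. *)
Lemma wave_pderiv_decay u N k : gaussian_wave u ->
  exists M, forall s y, (size s <= k)%N -> (1 + enorm y) ^+ N * `|pderiv s u y| <= M.
Proof.
elim: k u => [|k IH] u wu.
  have [M HM] := wave_decay N wu; exists M => s y.
  by rewrite leqn0 size_eq0 => /eqP ->; exact: HM.
have [M0 HM0] := wave_decay N wu.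
have /choice[M HM] : forall j : 'I_n, exists M, forall s y, (size s <= k)%N ->
    (1 + enorm y) ^+ N * `|pderiv (rcons s j) u y| <= M.
  move=> j; have [u' wu' du'] := wave_derive j wu.
  have [M HM] := IH _ wu'; exists M => s y sk.
  rewrite /pderiv foldr_rcons.
  rewrite (_ : (fun y => _) = u'); first exact: HM.
  by apply/funext => z; have [_ ->] := du' z.
exists (`|M0| + \sum_j `|M j|) => s y.
have H0 : 0 <= \sum_j `|M j| by apply: sumr_ge0.
case/lastP: s => [_|s j].
  by apply: (le_trans (HM0 y)); rewrite (le_trans (ler_norm _))// lerDl.
rewrite size_rcons ltnS => sk; apply: (le_trans (HM j s y sk)).
rewrite (le_trans (ler_norm _))// (bigD1 j)//= addrCA lerDl addr_ge0//.
by apply: sumr_ge0.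
Qed.

Lemma wave_smooth u : gaussian_wave u -> smooth u.
Proof.
move=> wu s; have ws := wave_pderiv s wu; split; first exact: wave_continuous.
by move=> j y; have [u' _ /(_ y) []] := wave_derive j ws.
Qed.

Lemma normc_le (z : R[i]) : Normc.normc z <= `|complex.Re z| + `|complex.Im z|.
Proof.
case: z => a b /=; rewrite -(ler_pXn2r (n := 2)) ?nnegrE ?sqrtr_ge0 ?addr_ge0//.
rewrite sqr_sqrtr ?addr_ge0 ?sqr_ge0// sqrrD !real_normK ?num_real//.
by rewrite lerD2r lerDl mulrn_wge0// mulr_ge0.
Qed.

Lemma wave_schwartz (phi : 'rV[R]_n -> R[i]) :
  gaussian_wave (fun y => complex.Re (phi y)) ->
  gaussian_wave (fun y => complex.Im (phi y)) -> schwartz phi.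
Proof.
move=> wr wi; split; [exact: wave_smooth|exact: wave_smooth|move=> N].
have [Mr HMr] := wave_pderiv_decay N N wr; have [Mi HMi] := wave_pderiv_decay N N wi.
apply: (@le_lt_trans _ _ (Mr + Mi)%:E); last exact: ltry.
apply: ge_ereal_sup => _ [s [y [sN ->]]]; rewrite lee_fin.
apply: le_trans (lerD (HMr s y sN) (HMi s y sN)); rewrite -mulrDr.
by rewrite ler_wpM2l ?exprn_ge0 ?addr_ge0 ?enorm_ge0// normc_le.
Qed.

End gaussian_waves.

(** * The heat kernel as an explicit Fourier transform *)

Section heat_symbol.
Context (R : realType) (n : nat).
Implicit Types x y xi : 'rV[R]_n.

(** (2 pi)^{-n} e^{- t |xi|^2} e^{i x . xi}; the factor (2 pi)^{-n} compensates for the unnormalized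
    [fourier]. *)
Definition heat_symbol (t : R) x xi : R[i] :=
  ((2 * pi)^-1 ^+ n * (gaussian_rV t 0 xi * cos (dotp x xi))) +i*
  ((2 * pi)^-1 ^+ n * (gaussian_rV t 0 xi * sin (dotp x xi))).

Lemma schwartz_heat_symbol t x : 0 < t -> schwartz (heat_symbol t x).
Proof.
move=> t0; apply: (@wave_schwartz _ _ t x t0) => /=.
  apply: wave_scale; have := wave_base t x 0.
  by under eq_fun do rewrite addr0.
have -> : (fun y => (2 * pi)^-1 ^+ n * (gaussian_rV t 0 y * sin (dotp x y))) =
   (fun y => - (2 * pi)^-1 ^+ n * (gaussian_rV t 0 y * cos (dotp x y + pi / 2))).
  by apply/funext => y; rewrite cosDpihalf mulrN mulrNN.
by apply: wave_scale; exact: wave_base.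
Qed.

Lemma heat_constE (t : R) : 0 < t ->
  (2 * pi)^-1 ^+ n * Num.sqrt (pi / t) ^+ n = (4 * pi * t) `^ (- (n%:R / 2)) :> R.
Proof.
move=> t0; have p0 := pi_gt0 R.
have q0 : 0 < 4 * pi * t by rewrite !mulr_gt0.
have q1 := ltW q0.
rewrite powRN (mulrC n%:R) powRrM powR12_sqrt// powR_mulrn ?sqrtr_ge0//.
rewrite -exprMn -exprVn; congr (_ ^+ n).
have -> : 4 * pi * t = (2 * pi) ^+ 2 * (pi / t)^-1.
  by move: (pi : R) p0 => P P0; field; rewrite !gt_eqF.
by rewrite [in RHS]sqrtrM ?sqr_ge0// sqrtr_sqr sqrtrV ?divr_ge0 ?(ltW p0) ?(ltW t0)// ger0_norm ?mulr_ge0 ?(ltW p0)// [in RHS]invfM invrK.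
Qed.

(** The exponentials combine into e^{i (x - y) . xi}. Real and imaginary parts are Gaussian cosine
    integrals centred at 0 with phases 0 and pi / 2, so the second carries the factor cos (pi / 2) =
    0. *)
Lemma fourier_heat_symbol t x : 0 < t ->
  fourier (heat_symbol t x) = fun y => (heat_kernel t (x - y))%:C.
Proof.
move=> t0; apply/funext => y; rewrite /fourier /cintegral.
pose K : R := (2 * pi)^-1 ^+ n.
have ig p := integrable_gaussian_rV_cos 0 (x - y) p t0.
have FE p : \int[lebesgue_rV]_xi (K * (gaussian_rV t 0 xi * cos (dotp (x - y) xi + p))) =
    K * (cos p * (Num.sqrt (pi / t) ^+ n * gaussian_rV (4 * t)^-1 0 (x - y))).
  rewrite RintegralZl//; last exact: ig.
  rewrite /Rintegral integral_gaussian_rV_cos//=.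
  by rewrite [dotp (x - y) 0]big1 ?add0r// => i _; rewrite !mxE mulr0.
have -> : \int[lebesgue_rV]_xi complex.Re ((cos (dotp xi y) -i* sin (dotp xi y)) * heat_symbol t x xi) =
    (heat_kernel t (x - y)).
  transitivity (\int[lebesgue_rV]_xi (K * (gaussian_rV t 0 xi * cos (dotp (x - y) xi + 0)))).
    apply: eq_Rintegral => xi _ /=; rewrite addr0 dotpBl cosB (dotpC xi y) -/K; ring.
  rewrite FE cos0 mul1r mulrA heat_constE// /heat_kernel /gaussian_rV subr0.
  by rewrite [(4 * t)^-1 * _]mulrC.
have -> : \int[lebesgue_rV]_xi complex.Im ((cos (dotp xi y) -i* sin (dotp xi y)) * heat_symbol t x xi) = 0.
  transitivity (\int[lebesgue_rV]_xi (- K * (gaussian_rV t 0 xi * cos (dotp (x - y) xi + pi / 2)))).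
    apply: eq_Rintegral => xi _ /=; rewrite cosDpihalf dotpBl sinB (dotpC xi y) -/K; ring.
  transitivity (- \int[lebesgue_rV]_xi (K * (gaussian_rV t 0 xi * cos (dotp (x - y) xi + pi / 2)))).
    rewrite -[RHS]mulN1r -RintegralZl//; last exact: (integrableZl measurableT K (ig _)).
    by apply: eq_Rintegral => xi _; rewrite mulN1r mulNr.
  by rewrite FE cos_pihalf mul0r mulr0 oppr0.
by [].
Qed.

(** The kernel on which [heat] evaluates f is the transform of the symbol, so this is the value of
    [fourierD f] on a Schwartz function. *)
Lemma heatE (f : functional R n) (g : 'rV[R]_n -> R[i]) t x : 0 < t ->
  is_function (fourierD f) g -> integrableC (fun xi => g xi * heat_symbol t x xi) ->
  heat t f x = cintegral (fun xi => g xi * heat_symbol t x xi).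
Proof.
move=> t0 fg ig; rewrite /heat -fourier_heat_symbol//.
by rewrite -/(fourierD f _) fg//; exact: schwartz_heat_symbol.
Qed.

End heat_symbol.

(** * Plancherel-type identity *)

Section product_sigma_finite.
Context d1 d2 (T1 : measurableType d1) (T2 : measurableType d2) (R : realType).
Variables (m1 : {sigma_finite_measure set T1 -> \bar R})
          (m2 : {sigma_finite_measure set T2 -> \bar R}).

(* Canonical structure inference only finds product_measure1 to be
   sigma-finite for finite factors; hence this copy. *)
Definition product_sigma_finite : set (T1 * T2) -> \bar R := (m1 \x m2)%E.

HB.instance Definition _ := Measure.copy product_sigma_finite (m1 \x m2)%E.

Let product_sigma_finiteT : sigma_finite setT product_sigma_finite.
Proof.
have /sigma_finiteP[F [TF ndF Foo]] := sigma_finiteT m1.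
have /sigma_finiteP[G [TG ndG Goo]] := sigma_finiteT m2.
exists (fun k => F k `*` G k).
  apply/seteqP; split=> // -[x y] _.
  have [i _ Fx] : (\bigcup_i F i) x by rewrite -TF.
  have [j _ Gy] : (\bigcup_i G i) y by rewrite -TG.
  exists (maxn i j) => //; split => /=.
  - by move: x Fx; exact/subsetPset/ndF/leq_maxl.
  - by move: y Gy; exact/subsetPset/ndG/leq_maxr.
move=> k; have [mF Fk] := Foo k; have [mG Gk] := Goo k.
split; first exact: measurableX.
rewrite /product_sigma_finite product_measure1E// lte_mul_pinfty// ge0_fin_numE//.
Qed.

HB.instance Definition _ := Measure_isSigmaFinite.Build _ _ _ product_sigma_finite
  product_sigma_finiteT.

End product_sigma_finite.

Section integral_product.
Context d1 d2 (T1 : measurableType d1) (T2 : measurableType d2) (R : realType).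
Variables (m1 : {sigma_finite_measure set T1 -> \bar R})
          (m2 : {sigma_finite_measure set T2 -> \bar R}).

Lemma integrable_prod (f : T1 -> R) (g : T2 -> R) :
  m1.-integrable setT (EFin \o f) -> m2.-integrable setT (EFin \o g) ->
  (product_sigma_finite m1 m2).-integrable setT (fun z => (f z.1 * g z.2)%:E).
Proof.
move=> intf intg.
have mf : measurable_fun setT f by apply/measurable_EFinP; exact: measurable_int intf.
have mg : measurable_fun setT g by apply/measurable_EFinP; exact: measurable_int intg.
apply/integrable12ltyP.
  apply/measurable_EFinP; apply: measurable_funM.
    exact: measurableT_comp mf measurable_fst.
  exact: measurableT_comp mg measurable_snd.
have /integrableP[_ foo] := intf; have /integrableP[_ goo] := intg.
have H : forall x, (\int[m2]_y `|(f x * g y)%:E| = `|(f x)%:E| * \int[m2]_y `|(g y)%:E|)%E.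
  move=> x; rewrite -ge0_integralZl//; last first.
    by apply: measurableT_comp => //; apply/measurable_EFinP.
  by apply: eq_integral => y _; rewrite EFinM abseM.
under eq_integral do rewrite H.
rewrite ge0_integralZr//; last 2 first.
- by apply: measurableT_comp => //; apply/measurable_EFinP.
- exact: integral_ge0.
by rewrite lte_mul_pinfty ?integral_ge0// ge0_fin_numE// integral_ge0.
Qed.

Lemma integral_prod (f : T1 -> R) (g : T2 -> R) :
  m1.-integrable setT (EFin \o f) -> m2.-integrable setT (EFin \o g) ->
  \int[(product_sigma_finite m1 m2)]_z (f z.1 * g z.2) = \int[m1]_x f x * \int[m2]_x g x.
Proof.
move=> intf intg.
rewrite /Rintegral -(integral12_prod_meas1 (integrable_prod intf intg)) /fubini_F/=.
rewrite -[RHS]RintegralZr//; congr fine; apply: eq_integral => x _.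
transitivity ((f x)%:E * \int[m2]_y (g y)%:E)%E; first by rewrite -integralZl.
by rewrite EFinM /Rintegral fineK//; exact: (integrable_fin_num measurableT intg).
Qed.

End integral_product.

Section plancherel_square.
Context d1 d2 (Y : measurableType d1) (X : measurableType d2) (R : realType).
Variables (m1 : {sigma_finite_measure set Y -> \bar R})
          (m2 : {sigma_finite_measure set X -> \bar R}).
Let mm := product_sigma_finite m2 m2.
Variables (F1 F2 : Y -> X -> R) (M : X -> R) (w : Y -> R).
Hypothesis mF1 : measurable_fun setT (fun p : Y * X => F1 p.1 p.2).
Hypothesis mF2 : measurable_fun setT (fun p : Y * X => F2 p.1 p.2).
Hypothesis F1M : forall y x, `|F1 y x| <= M x.
Hypothesis F2M : forall y x, `|F2 y x| <= M x.
Hypothesis intM : m2.-integrable setT (EFin \o M).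
Hypothesis intw : m1.-integrable setT (EFin \o w).

(** The real part of F(y, z.1) times the conjugate of F(y, z.2), for F = F1 + i F2. *)
Let Phi y (z : X * X) := F1 y z.1 * F1 y z.2 + F2 y z.1 * F2 y z.2.

Let mFy (F : Y -> X -> R) y : measurable_fun setT (fun p : Y * X => F p.1 p.2) ->
  measurable_fun setT (F y).
Proof.
move=> mF; have : measurable_fun setT (fun x : X => (y, x)) by exact: measurable_pair1.
exact: (measurableT_comp mF).
Qed.

Let intF (F : Y -> X -> R) y : measurable_fun setT (fun p : Y * X => F p.1 p.2) ->
  (forall y x, `|F y x| <= M x) -> m2.-integrable setT (EFin \o F y).
Proof.
move=> mF FM; apply: (le_integrable measurableT _ _ intM).
  by apply/measurable_EFinP; exact: mFy.
by move=> x _ /=; rewrite lee_fin (le_trans (FM y x))// ler_norm.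
Qed.

Let sqr_intF (F : Y -> X -> R) y : measurable_fun setT (fun p : Y * X => F p.1 p.2) ->
  (forall y x, `|F y x| <= M x) ->
  (\int[m2]_x F y x) ^+ 2 = \int[mm]_z (F y z.1 * F y z.2).
Proof. by move=> mF FM; rewrite integral_prod; [rewrite expr2|exact: intF|exact: intF]. Qed.

Let intPhi y : mm.-integrable setT (EFin \o Phi y).
Proof.
have i1 := integrable_prod (intF y mF1 F1M) (intF y mF1 F1M).
have i2 := integrable_prod (intF y mF2 F2M) (intF y mF2 F2M).
have := integrableD measurableT i1 i2.
by apply: eq_integrable.
Qed.

Let mPhi : measurable_fun setT (fun p : Y * (X * X) => (w p.1 * Phi p.1 p.2)%:E).
Proof.
have mw : measurable_fun setT w by apply/measurable_EFinP; exact: measurable_int intw.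
have m11 (F : Y -> X -> R) : measurable_fun setT (fun p : Y * X => F p.1 p.2) ->
    measurable_fun setT (fun p : Y * (X * X) => F p.1 p.2.1).
  move=> mF; apply: (measurableT_comp (f := fun p : Y * X => F p.1 p.2) (g := fun p : Y * (X * X) => (p.1, p.2.1))) => //.
  apply: measurable_fun_pair => //; exact: measurableT_comp.
have m12 (F : Y -> X -> R) : measurable_fun setT (fun p : Y * X => F p.1 p.2) ->
    measurable_fun setT (fun p : Y * (X * X) => F p.1 p.2.2).
  move=> mF; apply: (measurableT_comp (f := fun p : Y * X => F p.1 p.2) (g := fun p : Y * (X * X) => (p.1, p.2.2))) => //.
  apply: measurable_fun_pair => //; exact: measurableT_comp.
apply/measurable_EFinP; apply: measurable_funM; first exact: measurableT_comp.
by apply: measurable_funD; apply: measurable_funM; (exact: m11 || exact: m12).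
Qed.

(** [Phi] oscillates, so Fubini needs absolute integrability. The majorant w(y) 2 M(z.1) M(z.2)
    separates the variables; the 2 counts the products of [F1] and of [F2]. *)
Let intwPhi : (m1 \x mm)%E.-integrable setT (fun p => (w p.1 * Phi p.1 p.2)%:E).
Proof.
have iMM := integrable_prod intM intM.
have iMM2 : mm.-integrable setT (EFin \o (fun z => 2 * (M z.1 * M z.2))).
  exact: (integrableZl measurableT 2 iMM).
have iwMM := integrable_prod intw iMM2.
apply: (le_integrable measurableT _ _ iwMM); first exact: mPhi.
move=> -[y [x1 x2]] _ /=.
have M0 x : 0 <= M x by exact: le_trans (normr_ge0 _) (F1M y x).
rewrite lee_fin !normrM ler_wpM2l//; rewrite (ger0_norm (M0 _)) (ger0_norm (M0 _)) normr_nat.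
rewrite /Phi/= (le_trans (ler_normD _ _))// !normrM mulr_natl mulr2n.
by apply: lerD; apply: ler_pM.
Qed.

(* Applied to the real and imaginary parts F1 and F2 of a kernel, this is the
   expansion of the square of a modulus as a double integral. *)
Lemma integral_sqr_swap :
  (\int[m1]_y (w y * ((\int[m2]_x F1 y x) ^+ 2 + (\int[m2]_x F2 y x) ^+ 2))%:E =
   \int[product_sigma_finite m2 m2]_z (\int[m1]_y (w y * Phi y z)%:E))%E.
Proof.
rewrite -(Fubini intwPhi)/=; apply: eq_integral => y _.
have iwy : mm.-integrable setT (EFin \o (fun z => w y * Phi y z)).
  exact: (integrableZl measurableT (w y) (intPhi y)).
rewrite -[RHS]fineK; last exact: (integrable_fin_num measurableT iwy).
congr EFin; rewrite -/(Rintegral _ _ _) (sqr_intF _ mF1)// (sqr_intF _ mF2)//.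
rewrite -RintegralD//.
- by rewrite -RintegralZl//; exact: intPhi.
- exact: (integrable_prod (intF y mF1 F1M) (intF y mF1 F1M)).
- exact: (integrable_prod (intF y mF2 F2M) (intF y mF2 F2M)).
Qed.

End plancherel_square.

(** * One-dimensional power weights *)

Section power_integrals.
Context (R : realType).
Notation mu := (@lebesgue_measure R).

(** Monotone convergence for a uniform bound; it carries estimates on compact intervals to the
    singularity at 0 and to infinity. *)
Lemma ge0_integral_bigcup_le d (T : measurableType d) (m : {measure set T -> \bar R})
    (F : (set T)^nat) (f : T -> \bar R) K :
  nondecreasing_seq F -> (forall i, measurable (F i)) ->
  measurable_fun setT f -> (forall x, 0 <= f x)%E ->
  (forall i, \int[m]_(x in F i) f x <= K)%E ->
  (\int[m]_(x in \bigcup_i F i) f x <= K)%E.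
Proof.
move=> ndF mF mf f0 FK.
have mFf i : measurable_fun (F i) f by exact: measurable_funTS.
have h : (\int[m]_(x in F i) f x)%E @[i --> \oo] --> (\int[m]_(x in \bigcup_i F i) f x)%E.
  exact: (ge0_nondecreasing_set_cvg_integral ndF mF mFf (fun i x _ => f0 x)).
rewrite -(cvg_lim _ h)//; apply: lime_le; first by apply/cvg_ex; eexists; exact: h.
exact: nearW.
Qed.

Lemma integral_powR_itv (p a b : R) : p != 1 -> 0 < a -> a < b ->
  (\int[mu]_(x in `[a, b]) (x `^ (- p))%:E =
   ((b `^ (1 - p) - a `^ (1 - p)) / (1 - p))%:E)%E.
Proof.
move=> p1 a0 ab; have q0 : 1 - p != 0 by rewrite subr_eq0 eq_sym.
pose F x : R := x `^ (1 - p) / (1 - p).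
have dF (x : R) : 0 < x -> is_derive x (1 : R) F (x `^ (- p)).
  move=> x0; have d1 := is_derive1_powR (1 - p) x0.
  apply: is_derive_eq; rewrite /GRing.scale/= !mulr0 add0r mulrA mulVf// mul1r.
  by rewrite addrAC subrr add0r.
have cF (x : R) : 0 < x -> {for x, continuous F}.
  move=> x0; apply: differentiable_continuous; apply/derivable1_diffP.
  by have [] := dF x x0.
rewrite (continuous_FTC2 (F := F))//.
- by rewrite -EFinB /F mulrBl.
- apply: continuous_in_subspaceT => x /set_mem /=; rewrite in_itv/= => /andP[ax _].
  have x0 : 0 < x by exact: lt_le_trans ax.
  apply: differentiable_continuous; apply/derivable1_diffP.
  by have [] := is_derive1_powR (- p) x0.
- split.
  + move=> x; rewrite in_itv/= => /andP[ax _].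
    by have [] := dF x (lt_trans a0 ax).
  + by apply: cvg_at_right_filter; exact: cF.
  + by apply: cvg_at_left_filter; apply: cF; exact: lt_trans ab.
- move=> x; rewrite in_itv/= => /andP[ax _].
  by rewrite derive1E; have [_ ->] := dF x (lt_trans a0 ax).
Qed.

Let mpowR p : measurable_fun setT (fun x : R => x `^ (- p)).
Proof. exact: measurable_powR. Qed.

Let mpowRE p : measurable_fun [set: measurableTypeR R] (fun x : R => (x `^ (- p))%:E).
Proof. exact: measurable_EFin_lebesgue. Qed.

Lemma integral_powR_near0_le (p d : R) : 0 < p -> p < 1 -> 0 < d ->
  (\int[mu]_(x in `]0%R, d]) (x `^ (- p))%:E <= (d `^ (1 - p) / (1 - p))%:E)%E.
Proof.
move=> p0 p1 d0.
(* The denominator [i.+2] keeps every left end strictly below [d], so each interval is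
   nondegenerate. *)
have -> : [set` `]0, d]%R] = \bigcup_(i : nat) [set` `[d / i.+2%:R, d]%R].
  apply/seteqP; split => x /=.
    rewrite in_itv/= => /andP[x0 xd]; exists (Num.trunc (d / x)) => //=.
    rewrite in_itv/= xd andbT ler_pdivrMr ?ltr0n// mulrC -ler_pdivrMr//.
    by apply: ltW; apply: lt_le_trans (truncnS_gt _) _; rewrite ler_nat.
  move=> [i _ /=]; rewrite !in_itv/= => /andP[ix ->]; rewrite andbT.
  by apply: lt_le_trans ix; rewrite divr_gt0.
apply: ge0_integral_bigcup_le.
- move=> i j ij; apply/subsetPset => x /=; rewrite !in_itv/= => /andP[ix ->].
  rewrite andbT; apply: le_trans ix; rewrite ler_wpM2l ?(ltW d0)//.
  by rewrite lef_pV2 ?posrE ?ltr0n// ler_nat.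
- by move=> i; exact: measurable_itv.
- exact: mpowRE.
- by move=> x; rewrite lee_fin powR_ge0.
- move=> i; rewrite integral_powR_itv ?lt_eqF ?divr_gt0//; last first.
    by rewrite ltr_pdivrMr ?ltr0n// ltr_pMr// ltr1n.
  rewrite lee_fin ler_wpM2r ?invr_ge0 ?subr_ge0 ?(ltW p1)//.
  by rewrite gerBl powR_ge0.
Qed.

Lemma integral_powR_tail_le (p d : R) : 1 < p -> 0 < d ->
  (\int[mu]_(x in `[d, +oo[) (x `^ (- p))%:E <= (d `^ (1 - p) / (p - 1))%:E)%E.
Proof.
move=> p1 d0.
have -> : [set` `[d, +oo[%R] = \bigcup_(i : nat) [set` `[d, d + i.+1%:R]%R].
  apply/seteqP; split => x /=.
    rewrite in_itv/= andbT => dx; exists (Num.trunc (x - d)) => //=.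
    rewrite in_itv/= dx/= -lerBlDl.
    by apply: ltW; exact: truncnS_gt.
  by move=> [i _ /=]; rewrite !in_itv/= => /andP[->].
apply: ge0_integral_bigcup_le.
- move=> i j ij; apply/subsetPset => x /=; rewrite !in_itv/= => /andP[->] xi/=.
  by apply: le_trans xi _; rewrite lerD2l ler_nat.
- by move=> i; exact: measurable_itv.
- exact: mpowRE.
- by move=> x; rewrite lee_fin powR_ge0.
- move=> i; rewrite integral_powR_itv ?gt_eqF//; last by rewrite ltrDl ltr0n.
  have flip (A B : R) : (A - B) / (1 - p) = (B - A) / (p - 1).
    by rewrite -[1 - p]opprB invrN mulrN -mulNr opprB.
  rewrite lee_fin flip ler_wpM2r ?invr_ge0 ?subr_ge0 ?(ltW p1)//.
  by rewrite gerBl powR_ge0.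
Qed.

Lemma ge0_integral_even_le (f : R -> \bar R) K :
  measurable_fun [set: R] f -> (forall x, 0 <= f x)%E -> (forall x, f (- x) = f x) ->
  (\int[mu]_(x in `]0%R, +oo[) f x <= K%:E)%E ->
  (\int[mu]_x f x <= (2 * K)%:E)%E.
Proof.
move=> mf f0 fN fK.
have h1 : (\int[mu]_(x in `]-oo, 0%R]) f x = \int[mu]_(x in `[0%R, +oo[) f x)%E.
  by rewrite ge0_integration_by_substitution0//; apply: eq_integral => x _; rewrite fN.
have h2 : (\int[mu]_(x in `[0%R, +oo[) f x = \int[mu]_(x in `]0%R, +oo[) f x)%E.
  by rewrite integral_itv_obnd_cbnd//; exact: measurable_funTS.
have -> : [set: R] = [set` `]-oo, 0]%R] `|` [set` `]0, +oo[%R].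
  apply/seteqP; split => // x _ /=; rewrite !in_itv/= andbT.
  by case: (leP x 0) => ?; [left|right].
rewrite ge0_integral_setU//=.
- by rewrite h1 h2 mulr_natl mulr2n EFinD leeD.
- exact: measurable_funTS.
- apply/disj_setPRL => x /=; rewrite !in_itv/= andbT => x0.
  by apply/negP; rewrite -ltNge.
Qed.

End power_integrals.

Section power_gaussian_double_integral.
Context (R : realType) (b d : R).
Notation mu := (@lebesgue_measure R).
Hypotheses (b12 : 1 / 2 < b) (b1 : b < 1) (d0 : 0 < d).

(* As 0 `^ (- b) = 0, this is not an upper bound for the singular power at 0. *)
Definition abs_powN (x : R) : R := `|x| `^ (- b).

(** Since b < 1 the weight is integrable at 0 but not at infinity, while its square is integrable at
    infinity because 2 b > 1. The far piece is therefore defined with the squared weight. *)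
Let near (x : R) := if `|x| <= d then `|x| `^ (- b) else 0.
Let far (x : R) := if `|x| <= d then 0 else `|x| `^ (- (2 * b)).
Let k (x y : R) := gaussian (4 * d ^+ 2)^-1 x y.
Let M := d `^ (- b).

Let b0 : 0 < b. Proof. by apply: lt_trans b12; rewrite divr_gt0. Qed.

Let mnorm : measurable_fun setT (fun x : R => `|x| <= d).
Proof. by apply: measurable_fun_ler => //; exact: measurableT_comp. Qed.

Lemma measurable_abs_powN : measurable_fun setT abs_powN.
Proof. by apply: (measurableT_comp (f := fun x => x `^ (- b))) => //; exact: measurable_powR. Qed.

Let mnear : measurable_fun setT near.
Proof. apply: measurable_fun_ifT => //; exact: measurable_abs_powN. Qed.

Let mfar : measurable_fun setT far.
Proof.
apply: measurable_fun_ifT => //.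
by apply: (measurableT_comp (f := fun x => x `^ (- (2 * b)))) => //; exact: measurable_powR.
Qed.

Let near_ge0 x : 0 <= near x.
Proof. by rewrite /near; case: ifP => // _; exact: powR_ge0. Qed.

Let far_ge0 x : 0 <= far x.
Proof. by rewrite /far; case: ifP => // _; exact: powR_ge0. Qed.

Lemma abs_powN_ge0 x : 0 <= abs_powN x.
Proof. exact: powR_ge0. Qed.

Let M_ge0 : 0 <= M. Proof. exact: powR_ge0. Qed.

Let far_le x : d < `|x| -> abs_powN x <= M.
Proof.
move=> dx; rewrite /abs_powN /M !powRN lef_pV2 ?posrE ?powR_gt0 ?(lt_trans d0 dx)//.
by apply: ge0_ler_powR; rewrite ?nnegrE ?(ltW d0) ?(ltW b0)// ltW.
Qed.

Let near_int : (\int[mu]_x (near x)%:E <= (2 * (d `^ (1 - b) / (1 - b)))%:E)%E.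
Proof.
apply: ge0_integral_even_le.
- exact: measurable_EFin_lebesgue.
- by move=> x; rewrite lee_fin.
- by move=> x; rewrite /near normrN.
apply: le_trans (integral_powR_near0_le b0 b1 d0).
rewrite integral_mkcond [leRHS]integral_mkcond le_eqVlt; apply/orP; left; apply/eqP.
apply: eq_integral => x _; rewrite !patchE !mem_setE !in_itv/= andbT /near.
by case: (ltP 0 x) => //= x0; rewrite (gtr0_norm x0); case: ifP.
Qed.

Let far_int : (\int[mu]_x (far x)%:E <= (2 * (d `^ (1 - 2 * b) / (2 * b - 1)))%:E)%E.
Proof.
apply: ge0_integral_even_le.
- exact: measurable_EFin_lebesgue.
- by move=> x; rewrite lee_fin.
- by move=> x; rewrite /far normrN.
have b2 : 1 < 2 * b by move: b12; lra.
apply: le_trans (integral_powR_tail_le b2 d0).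
rewrite integral_mkcond [leRHS]integral_mkcond; apply: ge0_integral_mono.
  by move=> x _; rewrite patchE; case: ifP => // _; rewrite lee_fin.
move=> x _; rewrite !patchE !mem_setE !in_itv/= !andbT /far.
case: (ltP 0 x) => [x0|x0]; last by case: ifP => // _; rewrite lee_fin powR_ge0.
rewrite (gtr0_norm x0); case: (leP x d) => xd; last by rewrite (ltW xd).
by case: ifP => _ //; rewrite lee_fin powR_ge0.
Qed.

(* Both points near: the product itself. One near, one far: the far factor is at
   most M. Both far: AM-GM. *)
Let abs_powN_mul x y : abs_powN x * abs_powN y <=
  near x * near y + (M * near x + far x / 2) + (M * near y + far y / 2).
Proof.
have farE z : d < `|z| -> far z = abs_powN z ^+ 2.
  move=> dz; rewrite /far leNgt dz/= /abs_powN.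
  by rewrite -powR_mulrn ?powR_ge0// -powRrM; congr (_ `^ _); ring.
have x0 := abs_powN_ge0 x; have y0 := abs_powN_ge0 y.
have nx0 := near_ge0 x; have ny0 := near_ge0 y.
have fx0 := far_ge0 x; have fy0 := far_ge0 y.
have nn := mulr_ge0 nx0 ny0.
have Mx := mulr_ge0 M_ge0 nx0; have My := mulr_ge0 M_ge0 ny0.
case: (leP `|x| d) => xd.
  have nx : near x = abs_powN x by rewrite /near xd.
  case: (leP `|y| d) => yd.
    have ny : near y = abs_powN y by rewrite /near yd.
    move: nn Mx My; rewrite nx ny; lra.
  have := ler_wpM2l x0 (far_le yd); move: nn Mx My; rewrite nx; lra.
case: (leP `|y| d) => yd.
  have ny : near y = abs_powN y by rewrite /near yd.
  have := ler_wpM2r y0 (far_le xd); move: nn Mx My; rewrite ny; lra.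
have := sqr_ge0 (abs_powN x - abs_powN y).
move: nn Mx My; rewrite (farE _ xd) (farE _ yd) sqrrD sqrrN mulrN; lra.
Qed.

Let k0 : 0 < (4 * d ^+ 2)^-1.
Proof. by rewrite invr_gt0 mulr_gt0// exprn_gt0. Qed.

Let k_le1 x y : k x y <= 1.
Proof. by rewrite -expR0 ler_expR oppr_le0 mulr_ge0 ?sqr_ge0// ltW. Qed.

Let k_int x : (\int[mu]_y (k x y)%:E = (2 * Num.sqrt pi * d)%:E)%E.
Proof.
rewrite integral_gaussian// invrK mulrCA sqrtrM// sqrtrM ?pi_ge0// sqrtr_sqr gtr0_norm//.
by rewrite (_ : Num.sqrt 4 = 2) ?mulrA// (_ : 4 = 2 ^+ 2) ?sqrtr_sqr ?ger0_norm// -natrX.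
Qed.

Let k_sym x y : k x y = k y x.
Proof. by rewrite /k /gaussian -(sqrrN (y - x)) opprB. Qed.

Let mk2 : measurable_fun setT (fun z : R * R => k z.1 z.2).
Proof.
rewrite /k /gaussian; under eq_fun do rewrite -mulNr.
apply: (measurableT_comp (f := @expR R)) => //.
by apply: measurable_funM => //; apply: measurable_funX; apply: measurable_funB.
Qed.

Let q x := M * near x + far x / 2.
Let q_ge0 x : 0 <= q x.
Proof. by rewrite addr_ge0 ?mulr_ge0 ?divr_ge0. Qed.
Let mq : measurable_fun setT q.
Proof. by apply: measurable_funD; apply: measurable_funM. Qed.

Let q_int : (\int[mu]_x (q x)%:E <=
  (M * (2 * (d `^ (1 - b) / (1 - b))) + 2 * (d `^ (1 - 2 * b) / (2 * b - 1)) / 2)%:E)%E.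
Proof.
rewrite /q; under eq_integral do rewrite EFinD EFinM [(far _ / 2)%:E]EFinM.
rewrite ge0_integralD//.
- rewrite ge0_integralZl//.
  + rewrite ge0_integralZr//.
    * rewrite EFinD EFinM [(_ / 2)%:E]EFinM leeD//.
      - by rewrite lee_wpmul2l// lee_fin.
      - by rewrite lee_wpmul2r// lee_fin invr_ge0.
    * exact: measurable_EFin_lebesgue.
    * by move=> x _; rewrite lee_fin.
  + exact: measurable_EFin_lebesgue.
  + by move=> x _; rewrite lee_fin.
- by move=> x _; rewrite -EFinM lee_fin mulr_ge0.
- under eq_fun do rewrite -EFinM; apply: measurable_EFin_lebesgue.
  by apply: measurable_funM.
- by move=> x _; rewrite -EFinM lee_fin mulr_ge0.
- under eq_fun do rewrite -EFinM; apply: measurable_EFin_lebesgue.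
  by apply: measurable_funM.
Qed.

Definition power_gaussian (x : R) : R := \int[mu]_y (abs_powN y * k x y).

(** For |y| <= d the kernel is at most 1 and [near] is integrable; for |y| > d the weight is at most
    [M] and the kernel is integrable. *)
Let power_gaussian_bound x :
  (\int[mu]_y (abs_powN y * k x y)%:E < +oo)%E.
Proof.
apply: (@le_lt_trans _ _ (\int[mu]_y ((near y)%:E + M%:E * (k x y)%:E))%E).
  apply: ge0_integral_mono => y _; first by rewrite lee_fin mulr_ge0 ?abs_powN_ge0 ?gaussian_ge0.
  rewrite -EFinM -EFinD lee_fin.
  have ky := k_le1 x y; have ky0 := gaussian_ge0 (4 * d ^+ 2)^-1 x y; rewrite -/(k x y) in ky0.
  case: (leP `|y| d) => yd.
    rewrite (_ : near y = abs_powN y) ?/near ?yd//.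
    have := abs_powN_ge0 y; have := mulr_ge0 M_ge0 ky0; nra.
  by apply: ler_wpDl => //; rewrite ler_wpM2r// far_le.
rewrite ge0_integralD//.
- rewrite ge0_integralZl//.
  + rewrite k_int -EFinM; apply: lte_add_pinfty; last exact: ltry.
    by apply: le_lt_trans near_int _; exact: ltry.
  + exact: measurable_EFin_lebesgue (measurable_gaussian _ _).
  + by move=> y _; rewrite lee_fin gaussian_ge0.
- by move=> y _; rewrite lee_fin.
- exact: measurable_EFin_lebesgue.
- by move=> y _; rewrite -EFinM lee_fin mulr_ge0 ?gaussian_ge0.
- under eq_fun do rewrite -EFinM; apply: measurable_EFin_lebesgue.
  by apply: measurable_funM => //; exact: measurable_gaussian.
Qed.

Lemma power_gaussianE x :
  (\int[mu]_y (abs_powN y * gaussian (4 * d ^+ 2)^-1 x y)%:E = (power_gaussian x)%:E)%E.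
Proof.
rewrite /power_gaussian /Rintegral fineK// ge0_fin_numE; first exact: power_gaussian_bound.
by apply: integral_ge0 => y _; rewrite lee_fin mulr_ge0 ?abs_powN_ge0 ?gaussian_ge0.
Qed.

Lemma power_gaussian_ge0 x : 0 <= power_gaussian x.
Proof.
by apply: Rintegral_ge0 => y _; rewrite mulr_ge0 ?abs_powN_ge0 ?gaussian_ge0.
Qed.

Let mabsk : measurable_fun setT (fun z : R * R => (abs_powN z.2 * k z.1 z.2)%:E).
Proof.
apply/measurable_EFinP; apply: measurable_funM => //.
exact: measurableT_comp measurable_abs_powN measurable_snd.
Qed.

Lemma measurable_power_gaussian : measurable_fun setT power_gaussian.
Proof.
have absk0 (z : R * R) : (0 <= (abs_powN z.2 * k z.1 z.2)%:E)%E.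
  by rewrite lee_fin mulr_ge0 ?abs_powN_ge0 ?gaussian_ge0.
have := measurable_fun_fubini_tonelli_F (m2 := mu) _ mabsk absk0.
rewrite /fubini_F/= => h.
apply/measurable_EFinP; apply: eq_measurable_fun h => x _.
by rewrite power_gaussianE.
Qed.

(** The three terms of [abs_powN_mul] are integrated against the kernel. In the first the kernel is
    bounded by 1, leaving the square of the near integral; in the others it is integrated in the
    variable absent from [q], with mass 2 sqrt(pi) d. Cutting the weight at [d], the width of the
    kernel, makes every term scale like d^{2 - 2b}. *)
Lemma integral_power_gaussian_le :
  (\int[mu]_x (abs_powN x * power_gaussian x)%:E <=
   ((4 / (1 - b) ^+ 2 + 4 * Num.sqrt pi * (2 / (1 - b) + 1 / (2 * b - 1))) *
     d `^ (2 - 2 * b))%:E)%E.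
Proof.
pose near2 (z : R * R) := (near z.1 * near z.2)%:E.
pose q1 (z : R * R) := (q z.1 * k z.1 z.2)%:E.
pose q2 (z : R * R) := (q z.2 * k z.1 z.2)%:E.
have mnear2 : measurable_fun setT near2.
  apply/measurable_EFinP; apply: measurable_funM.
    exact: measurableT_comp mnear measurable_fst.
  exact: measurableT_comp mnear measurable_snd.
have mq1 : measurable_fun setT q1.
  apply/measurable_EFinP; apply: measurable_funM => //.
  exact: measurableT_comp mq measurable_fst.
have mq2 : measurable_fun setT q2.
  apply/measurable_EFinP; apply: measurable_funM => //.
  exact: measurableT_comp mq measurable_snd.
have near2_ge0 z : (0 <= near2 z)%E by rewrite lee_fin mulr_ge0.
have q1_ge0 z : (0 <= q1 z)%E by rewrite lee_fin mulr_ge0 ?gaussian_ge0.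
have q2_ge0 z : (0 <= q2 z)%E by rewrite lee_fin mulr_ge0 ?gaussian_ge0.
set A := 2 * (d `^ (1 - b) / (1 - b)).
set Q := M * A + 2 * (d `^ (1 - 2 * b) / (2 * b - 1)) / 2.
set K := 2 * Num.sqrt pi * d.
have K0 : 0 <= K by rewrite !mulr_ge0 ?sqrtr_ge0// ltW.
have A0 : 0 <= A by rewrite mulr_ge0// divr_ge0 ?powR_ge0// subr_ge0 ltW.
have I1 : (\int[(mu \x mu)%E]_z near2 z <= (A * A)%:E)%E.
  rewrite fubini_tonelli1// /fubini_F/=.
  rewrite (_ : (fun x => _) = (fun x : R => ((near x)%:E * \int[mu]_y (near y)%:E)%E)); last first.
    apply/funext => x; rewrite -ge0_integralZl ?lee_fin//.
      exact: measurable_EFin_lebesgue.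
    by move=> y _; rewrite lee_fin.
  rewrite ge0_integralZr//.
  - rewrite EFinM; apply: lee_pmul; try exact: near_int;
      by apply: integral_ge0 => x _; rewrite lee_fin; exact: near_ge0.
  - exact: measurable_EFin_lebesgue.
  - by move=> x _; rewrite lee_fin.
  - by apply: integral_ge0 => x _; rewrite lee_fin.
have q_intK : (\int[mu]_x ((q x)%:E * K%:E) <= (Q * K)%:E)%E.
  rewrite ge0_integralZr//.
  - by rewrite [leRHS]EFinM lee_wpmul2r// lee_fin.
  - exact: measurable_EFin_lebesgue.
  - by move=> x _; rewrite lee_fin.
have I2 : (\int[(mu \x mu)%E]_z q1 z <= (Q * K)%:E)%E.
  rewrite fubini_tonelli1// /fubini_F/=.
  rewrite (_ : (fun x => _) = (fun x : R => ((q x)%:E * K%:E)%E))//.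
  apply/funext => x; rewrite /K -(k_int x) -ge0_integralZl//.
  - exact: measurable_EFin_lebesgue (measurable_gaussian _ _).
  - by move=> y _; rewrite lee_fin gaussian_ge0.
  - by rewrite lee_fin.
have I3 : (\int[(mu \x mu)%E]_z q2 z <= (Q * K)%:E)%E.
  rewrite fubini_tonelli2// /fubini_G/=.
  rewrite (_ : (fun y => _) = (fun y : R => ((q y)%:E * K%:E)%E))//.
  apply/funext => y; rewrite /K -(k_int y) -ge0_integralZl//.
  - by apply: eq_integral => x _; rewrite /q2/= k_sym.
  - exact: measurable_EFin_lebesgue (measurable_gaussian _ _).
  - by move=> x _; rewrite lee_fin gaussian_ge0.
  - by rewrite lee_fin.
apply: (@le_trans _ _ (\int[(mu \x mu)%E]_z (near2 z + q1 z + q2 z))%E).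
  rewrite fubini_tonelli1//; last by move=> z; rewrite !adde_ge0.
    apply: ge0_integral_mono => x _.
      by rewrite lee_fin mulr_ge0 ?abs_powN_ge0 ?power_gaussian_ge0.
    rewrite EFinM -power_gaussianE -ge0_integralZl//.
    - apply: ge0_integral_mono => y _.
        by rewrite -EFinM lee_fin !mulr_ge0 ?abs_powN_ge0 ?gaussian_ge0.
      rewrite /near2 /q1 /q2/= -EFinM -!EFinD lee_fin mulrA -/(k x y).
      have ky := k_le1 x y; have ky0 := gaussian_ge0 (4 * d ^+ 2)^-1 x y; rewrite -/(k x y) in ky0.
      apply: (le_trans (ler_wpM2r ky0 (abs_powN_mul x y))).
      rewrite -/(q x) -/(q y) !mulrDl !lerD2r.
      by rewrite ler_piMr// mulr_ge0.
    - apply: measurable_EFin_lebesgue; apply: measurable_funM.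
        exact: measurable_abs_powN.
      exact: measurable_gaussian.
    - by move=> y _; rewrite lee_fin mulr_ge0 ?abs_powN_ge0 ?gaussian_ge0.
    - by rewrite lee_fin abs_powN_ge0.
  by apply: emeasurable_funD => //; exact: emeasurable_funD.
rewrite ge0_integralD//; [|by move=> z _; rewrite adde_ge0|exact: emeasurable_funD].
rewrite ge0_integralD//.
apply: le_trans (leeD (leeD I1 I2) I3) _; rewrite -!EFinD lee_fin le_eqVlt; apply/orP; left; apply/eqP.
have dN0 : d != 0 by rewrite gt_eqF.
have e1 : d `^ (1 - b) * d `^ (1 - b) = d `^ (2 - 2 * b).
  by rewrite -powRD ?dN0 ?implybT//; congr (_ `^ _); ring.
have e2 : d * (M * d `^ (1 - b)) = d `^ (2 - 2 * b).
  rewrite /M -{1}(powRr1 (ltW d0)) -!powRD ?dN0 ?implybT//; congr (_ `^ _); ring.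
have e3 : d * d `^ (1 - 2 * b) = d `^ (2 - 2 * b).
  rewrite -{1}(powRr1 (ltW d0)) -!powRD ?dN0 ?implybT//; congr (_ `^ _); ring.
have b1' : 1 - b != 0 by rewrite subr_eq0 gt_eqF.
have b2' : 2 * b - 1 != 0 by rewrite subr_eq0 gt_eqF//; move: b12; lra.
have -> : A * A + Q * K + Q * K =
  4 / (1 - b) ^+ 2 * (d `^ (1 - b) * d `^ (1 - b)) + 4 * Num.sqrt pi *
   (2 / (1 - b) * (d * (M * d `^ (1 - b))) + 1 / (2 * b - 1) * (d * d `^ (1 - 2 * b))).
  rewrite /Q /K /A /M; move: (d `^ (1 - b)) (d `^ (1 - 2 * b)) (d `^ (- b)) => u v m.
  by move: (Num.sqrt _) => s; field; rewrite b1' b2'.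
rewrite e1 e2 e3; ring.
Qed.

End power_gaussian_double_integral.

(** * Local energy of the heat extension *)

Section boxes.
Context (R : realType) (n : nat).
Notation mu := (@lebesgue_measure R).
Implicit Types x y : 'rV[R]_n.

(** A product of interval indicators, so that [integral_prod_coord] applies. The cube bounds the
    volume of balls from below and localizes the convolution of the kernel. *)
Definition box_indic x (s : R) y : R :=
  \prod_i \1_([set` `]x ord0 i - s, x ord0 i + s[%R]) (y ord0 i).

Lemma integral_box_indic x s : 0 < s ->
  (\int[lebesgue_rV]_y (box_indic x s y)%:E = ((2 * s) ^+ n)%:E)%E.
Proof.
move=> s0; rewrite (integral_prod_coord
  (f := fun i => \1_([set` `]x ord0 i - s, x ord0 i + s[%R])) (c := fun=> 2 * s)).
- by rewrite prodr_const card_ord.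
- by move=> i; exact: measurable_indic.
- by move=> i y; rewrite indicE.
- move=> i; rewrite integral_indic// setIT.
  rewrite [LHS](lebesgue_measure_itv `]x ord0 i - s, x ord0 i + s[)/= lte_fin ifT; last by lra.
  by rewrite -EFinB; congr EFin; ring.
Qed.

Lemma box_indicP x s y :
  box_indic x s y = 0 \/ (box_indic x s y = 1 /\ forall i, `|(y - x) ord0 i| < s).
Proof.
have [h|/forallPn[i hi]] := boolP [forall i, `|(y - x) ord0 i| < s].
  right; split; last exact/forallP.
  rewrite /box_indic big1// => i _; rewrite indicE mem_set//=.
  by have /forallP/(_ i) := h; rewrite !mxE in_itv/= ltr_distl.
left; rewrite /box_indic (bigD1 i)//= indicE memNset ?mul0r//= in_itv/=.
by move: hi; rewrite !mxE ltr_distl => /negP.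
Qed.

Lemma eball_measure_ge x r : (0 < n)%N -> 0 < r ->
  (((2 * (r / n%:R)) ^+ n)%:E <= lebesgue_rV (eball x r))%E.
Proof.
move=> n0 r0; have s0 : 0 < r / n%:R by rewrite divr_gt0// ltr0n.
have -> : lebesgue_rV (eball x r) = (\int[lebesgue_rV]_y (\1_(eball x r) y)%:E)%E.
  by rewrite integral_indic ?setIT//; exact: measurable_eball.
rewrite -(integral_box_indic x s0).
apply: ge0_integral_mono => y _.
  by rewrite lee_fin; apply: prodr_ge0 => i _; rewrite indicE.
rewrite lee_fin; have [->|[-> h]] := box_indicP x (r / n%:R) y.
  by rewrite indicE.
by rewrite indicE mem_set// /eball/=; exact: enorm_lt_box.
Qed.

(** On a space of measure zero an essential supremum would be -oo; positive mass is what makes the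
    norms nonnegative. *)
Lemma lebesgue_rV_setT_gt0 : (0 < n)%N -> (0 < lebesgue_rV [set: 'rV[R]_n])%E.
Proof.
move=> n0; apply: (@lt_le_trans _ _ (lebesgue_rV (eball (0 : 'rV[R]_n) 1))).
  apply: lt_le_trans (eball_measure_ge 0 n0 ltr01).
  by rewrite lte_fin exprn_gt0// mulr_gt0// divr_gt0// ltr0n.
by apply: le_measure; rewrite ?inE//; exact: measurable_eball.
Qed.

(** The product weight takes the value 0 on the coordinate hyperplanes, so it majorizes |xi|^{theta
    - n} only off them; they must be seen to be null. *)
Lemma ae_coord_neq0 : {ae @lebesgue_rV R n, forall y : 'rV[R]_n, forall i, y ord0 i != 0}.
Proof.
have h (i : 'I_n) : {ae @lebesgue_rV R n, forall y : 'rV[R]_n, y ord0 i != 0}.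
  (* Gaussian in every coordinate, cut down to the point 0 in coordinate i. The product is
     nonnegative with integral 0, hence 0 almost everywhere, yet it is positive wherever y_i = 0. *)
  pose f (j : 'I_n) (t : R) := gaussian 1 0 t * (if j == i then \1_[set 0] t else 1).
  have f0 j t : 0 <= f j t by rewrite mulr_ge0 ?gaussian_ge0//; case: ifP => // _; rewrite indicE.
  have mf j : measurable_fun setT (f j).
    apply: measurable_funM; first exact: measurable_gaussian.
    by case: (j == i) => //; exact: measurable_indic.
  have If j : (\int[mu]_t (f j t)%:E = (if j == i then 0 else Num.sqrt (pi / 1))%:E)%E.
    rewrite /f; case: (j == i); last first.
      by under eq_integral do rewrite mulr1; rewrite integral_gaussian.
    under eq_integral do rewrite EFinM.
    transitivity (\int[mu]_(t in [set 0%R : R]) (gaussian 1 0 t)%:E)%E.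
      rewrite [RHS]integral_mkcond; apply: eq_integral => t _.
      rewrite patchE indicE; case: ifP => _; first by rewrite mule1.
      by rewrite mule0.
    by rewrite integral_set1.
  have := integral_prod_coord mf f0 If.
  rewrite (bigD1 i)//= eqxx mul0r => I0.
  have mP : measurable_fun setT (fun y : 'rV[R]_n => (\prod_j f j (y ord0 j))%:E).
    by apply/measurable_EFinP; exact: measurable_prod_coord.
  have P0 (y : 'rV[R]_n) : (0 <= (\prod_j f j (y ord0 j))%:E)%E.
    by rewrite lee_fin; apply: prodr_ge0.
  have : ae_eq (@lebesgue_rV R n) setT (fun y : 'rV[R]_n => (\prod_j f j (y ord0 j))%:E) (cst 0%E).
    apply/ae_eq_integral_abs => //.
    by under eq_integral do rewrite gee0_abs//.
  apply: filterS => y /= /(_ I) [] /eqP; rewrite prodf_seq_eq0 => /hasP[j _ /andP[_]].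
  rewrite /f mulf_eq0 gt_eqF ?gaussian_gt0//=; case: ifP => [/eqP ->|_].
    by rewrite indicE; have [->|//] := eqVneq (y ord0 i) 0; rewrite mem_set// oner_eq0.
  by rewrite oner_eq0.
by apply: filter_forall => i; exact: h.
Qed.

End boxes.

Section heat_energy.
Context (R : realType) (n : nat) (b : R).
Notation mu := (@lebesgue_measure R).
Hypotheses (b12 : 1 / 2 < b) (b1 : b < 1).
Implicit Types x y xi : 'rV[R]_n.

Definition weight_rV xi : R := \prod_i abs_powN b (xi ord0 i).

Lemma weight_rV_ge0 xi : 0 <= weight_rV xi.
Proof. by apply: prodr_ge0 => i _; exact: abs_powN_ge0. Qed.

Lemma measurable_weight_rV : measurable_fun setT weight_rV.
Proof. by apply: (measurable_prod_coord (f := fun=> abs_powN b)) => i; exact: measurable_abs_powN. Qed.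

Let kappa : R := (2 * pi)^-1 ^+ n.
Let kappa_ge0 : 0 <= kappa.
Proof. by rewrite exprn_ge0// invr_ge0 mulr_ge0// pi_ge0. Qed.

(** With [heat_im], the real and imaginary parts of (u + i v) times the heat symbol at y. *)
Definition heat_re (u v : 'rV[R]_n -> R) t y xi : R :=
  kappa * gaussian_rV t 0 xi * (u xi * cos (dotp y xi) - v xi * sin (dotp y xi)).

Definition heat_im (u v : 'rV[R]_n -> R) t y xi : R :=
  kappa * gaussian_rV t 0 xi * (u xi * sin (dotp y xi) + v xi * cos (dotp y xi)).

Definition heat_bound (K t : R) xi : R :=
  K * kappa * (weight_rV xi * gaussian_rV t 0 xi).

(* The constant of integral_power_gaussian_le. *)
Definition energy_const : R :=
  4 / (1 - b) ^+ 2 + 4 * Num.sqrt pi * (2 / (1 - b) + 1 / (2 * b - 1)).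

Variables (u v : 'rV[R]_n -> R) (K t : R).
Hypotheses (meas_u : measurable_fun setT u) (meas_v : measurable_fun setT v).
Hypotheses (K0 : 0 <= K) (t0 : 0 < t).
Hypothesis uvK : forall xi, `|u xi| + `|v xi| <= K * weight_rV xi.

Let M := heat_bound K t.

Let M_ge0 xi : 0 <= M xi.
Proof. by rewrite /M /heat_bound !mulr_ge0 ?weight_rV_ge0 ?gaussian_rV_ge0. Qed.

Let mM : measurable_fun setT M.
Proof.
rewrite /M /heat_bound; apply: measurable_funM => //; apply: measurable_funM.
  exact: measurable_weight_rV.
exact: measurable_gaussian_rV.
Qed.

Let intM : lebesgue_rV.-integrable setT (EFin \o M).
Proof.
(* The width for which 1 / (4 d^2) = t; the integral then factors into copies of [power_gaussian] at
   the origin. *)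
pose d := (2 * Num.sqrt t)^-1.
have d0 : 0 < d by rewrite invr_gt0 mulr_gt0// sqrtr_gt0.
have dt : (4 * d ^+ 2)^-1 = t.
  rewrite /d exprVn exprMn sqr_sqrtr ?(ltW t0)// invfM invrK.
  by rewrite (_ : 2 ^+ 2 = 4 :> R) ?mulKf// -natrX.
have iwg : lebesgue_rV.-integrable setT (EFin \o (fun xi => weight_rV xi * gaussian_rV t 0 xi)).
  apply/integrableP; split.
    apply/measurable_EFinP; apply: measurable_funM; first exact: measurable_weight_rV.
    exact: measurable_gaussian_rV.
  under eq_integral do rewrite /= ger0_norm ?mulr_ge0 ?weight_rV_ge0 ?gaussian_rV_ge0//.
  under eq_integral do rewrite gaussian_rVE -big_split/=.
  under eq_integral do under eq_bigr do rewrite mxE.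
  rewrite (integral_prod_coord (f := fun=> fun s => abs_powN b s * gaussian t 0 s)
    (c := fun=> power_gaussian b d 0)) ?ltry//.
  - move=> i; apply: measurable_funM; first exact: measurable_abs_powN.
    exact: measurable_gaussian.
  - by move=> i s; rewrite mulr_ge0 ?abs_powN_ge0 ?gaussian_ge0.
  - by move=> i; rewrite -(power_gaussianE b12 b1 d0) dt.
exact: (integrableZl measurableT (K * kappa) iwg).
Qed.

Let mcos2 : measurable_fun setT (fun p : 'rV[R]_n * 'rV[R]_n => cos (dotp p.1 p.2)).
Proof. by under eq_fun do rewrite -[dotp _ _]addr0; exact: measurable_cos_dotp. Qed.

Let msin2 : measurable_fun setT (fun p : 'rV[R]_n * 'rV[R]_n => sin (dotp p.1 p.2)).
Proof.
have h : measurable_fun setT (fun p : 'rV[R]_n * 'rV[R]_n => - cos (dotp p.1 p.2 + pi / 2)).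
  by apply: measurableT_comp => //; exact: measurable_cos_dotp.
by under eq_fun do rewrite -[sin _]opprK -cosDpihalf.
Qed.

Let msnd (f : 'rV[R]_n -> R) : measurable_fun setT f ->
  measurable_fun setT (fun p : 'rV[R]_n * 'rV[R]_n => f p.2).
Proof. by move=> mf; exact: measurableT_comp mf measurable_snd. Qed.

Lemma measurable_heat_re : measurable_fun setT (fun p : 'rV[R]_n * 'rV[R]_n => heat_re u v t p.1 p.2).
Proof.
apply: measurable_funM.
  by apply: measurable_funM => //; apply: (msnd (f := gaussian_rV t 0)); exact: measurable_gaussian_rV.
by apply: measurable_funB; apply: measurable_funM => //; exact: msnd.
Qed.

Lemma measurable_heat_im : measurable_fun setT (fun p : 'rV[R]_n * 'rV[R]_n => heat_im u v t p.1 p.2).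
Proof.
apply: measurable_funM.
  by apply: measurable_funM => //; apply: (msnd (f := gaussian_rV t 0)); exact: measurable_gaussian_rV.
by apply: measurable_funD; apply: measurable_funM => //; exact: msnd.
Qed.

Let kgM xi (s : R) : `|s| <= `|u xi| + `|v xi| -> `|kappa * gaussian_rV t 0 xi * s| <= M xi.
Proof.
move=> h; rewrite normrM ger0_norm ?mulr_ge0 ?gaussian_rV_ge0// /M /heat_bound.
rewrite [K * kappa]mulrC -!mulrA ler_wpM2l// mulrA mulrC ler_wpM2r ?gaussian_rV_ge0//.
exact: le_trans h (uvK xi).
Qed.

Lemma heat_re_le y xi : `|heat_re u v t y xi| <= M xi.
Proof.
apply: kgM; rewrite (le_trans (ler_normB _ _))// !normrM.
by apply: lerD; rewrite ler_piMr ?cos_max ?sin_max.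
Qed.

Lemma heat_im_le y xi : `|heat_im u v t y xi| <= M xi.
Proof.
apply: kgM; rewrite (le_trans (ler_normD _ _))// !normrM.
by apply: lerD; rewrite ler_piMr ?cos_max ?sin_max.
Qed.

Lemma integrable_heat_bound (f : 'rV[R]_n -> R) : measurable_fun setT f ->
  (forall xi, `|f xi| <= M xi) -> lebesgue_rV.-integrable setT (EFin \o f).
Proof.
move=> mf fM; apply: (le_integrable measurableT _ _ intM); first exact/measurable_EFinP.
by move=> xi _ /=; rewrite lee_fin (le_trans (fM xi))// ler_norm.
Qed.

Section at_scale.
Variables (x : 'rV[R]_n) (r : R).
Hypothesis r0 : 0 < r.

Let c := (r ^+ 2)^-1.
Let c0 : 0 < c. Proof. by rewrite invr_gt0 exprn_gt0. Qed.
(** The factor e offsets the value e^{-1} of the Gaussian on the sphere of radius r. *)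
Let w y := expR 1 * gaussian_rV c x y.
Let G xi := Num.sqrt (pi / c) ^+ n * gaussian_rV (4 * c)^-1 0 xi.
Let G_ge0 xi : 0 <= G xi.
Proof. by rewrite mulr_ge0 ?gaussian_rV_ge0 ?exprn_ge0 ?sqrtr_ge0. Qed.

Let intw : lebesgue_rV.-integrable setT (EFin \o w).
Proof. exact: (integrableZl measurableT (expR 1) (integrable_gaussian_rV x c0)). Qed.

Let Phi y (z : 'rV[R]_n * 'rV[R]_n) :=
  heat_re u v t y z.1 * heat_re u v t y z.2 + heat_im u v t y z.1 * heat_im u v t y z.2.

(* The Gaussian weight is at least 1 on the ball of radius r, and its Fourier
   transform turns the oscillating double integral into a convolution with G. *)
Let int_Phi z : (\int[lebesgue_rV]_y (w y * Phi y z)%:E <=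
  (expR 1 * (M z.1 * M z.2 * G (z.1 - z.2)))%:E)%E.
Proof.
set N := kappa * gaussian_rV t 0 z.1 * (kappa * gaussian_rV t 0 z.2).
(* Up to the Gaussian in y, [A] and [B] are the coefficients of the cosine and the sine of (z.1 -
   z.2) . y in the integrand. *)
set A := expR 1 * N * (u z.1 * u z.2 + v z.1 * v z.2).
set B := expR 1 * N * (u z.1 * v z.2 - v z.1 * u z.2).
pose g p y := gaussian_rV c x y * cos (dotp (z.1 - z.2) y + p).
have ig p : lebesgue_rV.-integrable setT (EFin \o g p).
  exact: integrable_gaussian_rV_cos.
have E y : (w y * Phi y z)%:E = (A%:E * (g 0 y)%:E - B%:E * (g (pi / 2) y)%:E)%E.
  rewrite -!EFinM -EFinB; congr EFin.
  rewrite /g cosDpihalf addr0 dotpBl cosB sinB /w /Phi /heat_re /heat_im -/kappa.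
  rewrite !(dotpC y) /A /B /N.
  move: (gaussian_rV c x y) (gaussian_rV t 0 z.1) (gaussian_rV t 0 z.2) (expR 1).
  move: (cos (dotp z.1 y)) (sin (dotp z.1 y)) (cos (dotp z.2 y)) (sin (dotp z.2 y)).
  move: (u z.1) (v z.1) (u z.2) (v z.2) kappa => u1 v1 u2 v2 k c1 s1 c2 s2 g0 g1 g2 e.
  ring.
under eq_integral do rewrite E.
have iA := integrableZl measurableT A (ig 0).
have iB := integrableZl measurableT B (ig (pi / 2)).
rewrite (integralB measurableT iA iB) (integralZl measurableT (ig _)) (integralZl measurableT (ig _)).
rewrite /g/= !integral_gaussian_rV_cos// -/(G _) -!EFinM -EFinB lee_fin.
(* The centre x survives only in these cosines, which are bounded by 1; the estimate is therefore
   uniform in x. *)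
set p1 := cos _; set p2 := cos _.
have N0 : 0 <= N by rewrite !mulr_ge0 ?gaussian_rV_ge0.
have NM : N * ((`|u z.1| + `|v z.1|) * (`|u z.2| + `|v z.2|)) <= M z.1 * M z.2.
  have -> : M z.1 * M z.2 = N * (K * weight_rV z.1 * (K * weight_rV z.2)).
    rewrite /M /heat_bound /N; move: (weight_rV z.1) (weight_rV z.2) (gaussian_rV t 0 z.1) (gaussian_rV t 0 z.2) kappa.
    by move=> w1 w2 g1 g2 k; ring.
  by rewrite ler_wpM2l// ler_pM ?addr_ge0.
apply: (le_trans (ler_norm _)).
have -> : A * (p1 * G (z.1 - z.2)) - B * (p2 * G (z.1 - z.2)) =
  expR 1 * (N * ((u z.1 * u z.2 + v z.1 * v z.2) * p1 - (u z.1 * v z.2 - v z.1 * u z.2) * p2) * G (z.1 - z.2)).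
  by rewrite /A /B; ring.
rewrite normrM (ger0_norm (expR_ge0 1)); apply: ler_wpM2l; first exact: expR_ge0.
rewrite normrM (ger0_norm (G_ge0 _)); apply: ler_wpM2r; first exact: G_ge0.
rewrite normrM (ger0_norm N0); apply: le_trans NM; apply: ler_wpM2l => //.
rewrite (le_trans (ler_normB _ _))// !normrM.
have -> : (`|u z.1| + `|v z.1|) * (`|u z.2| + `|v z.2|) =
  (`|u z.1 * u z.2| + `|v z.1 * v z.2|) + (`|u z.1 * v z.2| + `|v z.1 * u z.2|).
  by rewrite !normrM; ring.
have cm (s : R) : `|cos s| <= 1 by exact: cos_max.
apply: lerD.
  apply: (@le_trans _ _ `|u z.1 * u z.2 + v z.1 * v z.2|); last exact: ler_normD.
  by rewrite ler_piMr ?cm.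
apply: (@le_trans _ _ `|u z.1 * v z.2 - v z.1 * u z.2|); last exact: ler_normB.
by rewrite ler_piMr ?cm.
Qed.

Let mc : (4 * c)^-1 = (4 * r^-1 ^+ 2)^-1.
Proof. by rewrite /c exprVn. Qed.

Let rV0 : 0 < r^-1. Proof. by rewrite invr_gt0. Qed.

Let mG2 : measurable_fun setT (fun p : 'rV[R]_n * 'rV[R]_n => G (p.1 - p.2)).
Proof.
apply: measurable_funM => //; apply: measurable_gaussian_rV => //.
exact: measurable_rVB.
Qed.

(** 1 / (4 c) = r^2 / 4 = 1 / (4 d^2) for d = 1 / r: localizing at scale r smooths the frequency
    side at scale 1 / r. *)
Let int_inner xi : (\int[lebesgue_rV]_eta (weight_rV eta * gaussian_rV (4 * c)^-1 0 (xi - eta))%:E =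
   (\prod_i power_gaussian b r^-1 (xi ord0 i))%:E)%E.
Proof.
under eq_integral do rewrite gaussian_rVE -big_split/=.
rewrite -(integral_prod_coord (f := fun i s => abs_powN b s * gaussian (4 * r^-1 ^+ 2)^-1 (xi ord0 i) s)
    (c := fun i => power_gaussian b r^-1 (xi ord0 i))).
- apply: eq_integral => eta _; congr EFin; apply: eq_bigr => i _; congr (_ * _).
  by rewrite /gaussian !mxE subr0 -sqrrN opprB mc.
- move=> i; apply: measurable_funM; first exact: measurable_abs_powN.
  exact: measurable_gaussian.
- by move=> i s; rewrite mulr_ge0 ?abs_powN_ge0 ?gaussian_ge0.
- by move=> i; exact: power_gaussianE.
Qed.

Let int_outer : (\int[lebesgue_rV]_xi (weight_rV xi * \prod_i power_gaussian b r^-1 (xi ord0 i))%:E <=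
   ((energy_const * r^-1 `^ (2 - 2 * b)) ^+ n)%:E)%E.
Proof.
under eq_integral do rewrite -big_split/=.
have le1 := integral_power_gaussian_le b12 b1 rV0.
have ge0 : (0 <= \int[mu]_s (abs_powN b s * power_gaussian b r^-1 s)%:E)%E.
  by apply: integral_ge0 => s _; rewrite lee_fin mulr_ge0 ?abs_powN_ge0 ?power_gaussian_ge0.
have fin : (\int[mu]_s (abs_powN b s * power_gaussian b r^-1 s)%:E)%E \is a fin_num.
  by rewrite ge0_fin_numE// (le_lt_trans le1)// ltry.
rewrite (integral_prod_coord (f := fun=> fun s => abs_powN b s * power_gaussian b r^-1 s)
    (c := fun=> fine (\int[mu]_s (abs_powN b s * power_gaussian b r^-1 s)%:E)%E)).
- rewrite prodr_const card_ord lee_fin lerXn2r ?nnegrE ?fine_ge0//.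
    by rewrite -lee_fin (le_trans ge0 le1).
  by rewrite -lee_fin fineK.
- move=> i; apply: measurable_funM; first exact: measurable_abs_powN.
  exact: measurable_power_gaussian.
- by move=> i s; rewrite mulr_ge0 ?abs_powN_ge0 ?power_gaussian_ge0.
- by move=> i; rewrite fineK.
Qed.

Lemma heat_energy_le :
  (\int[lebesgue_rV]_(y in eball x r)
     ((\int[lebesgue_rV]_xi heat_re u v t y xi) ^+ 2 +
      (\int[lebesgue_rV]_xi heat_im u v t y xi) ^+ 2)%:E <=
   (expR 1 * (K * kappa) ^+ 2 * Num.sqrt (pi / (r ^+ 2)^-1) ^+ n *
     (energy_const * r^-1 `^ (2 - 2 * b)) ^+ n)%:E)%E.
Proof.
have w0 y : 0 <= w y by rewrite mulr_ge0 ?expR_ge0.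
apply: (@le_trans _ _ (\int[lebesgue_rV]_y (w y *
   ((\int[lebesgue_rV]_xi heat_re u v t y xi) ^+ 2 +
      (\int[lebesgue_rV]_xi heat_im u v t y xi) ^+ 2))%:E)%E).
  rewrite integral_mkcond; apply: ge0_integral_mono => y _.
    by rewrite patchE; case: ifP => // _; rewrite lee_fin addr_ge0 ?sqr_ge0.
  rewrite patchE; case: ifP => [/set_mem yr|_]; last by rewrite lee_fin mulr_ge0// addr_ge0 ?sqr_ge0.
  rewrite lee_fin ler_peMl ?addr_ge0 ?sqr_ge0//.
  rewrite /w /gaussian_rV -expRD -[leLHS]expR0 ler_expR subr_ge0 /c mulrC.
  rewrite ler_pdivrMr ?exprn_gt0// mul1r lerXn2r ?nnegrE ?enorm_ge0 ?(ltW r0)//.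
  exact: ltW.
rewrite (integral_sqr_swap measurable_heat_re measurable_heat_im heat_re_le heat_im_le intM intw).
have wg_ge0 (xi eta : 'rV[R]_n) : 0 <= weight_rV eta * gaussian_rV (4 * c)^-1 0 (xi - eta).
  by rewrite mulr_ge0 ?weight_rV_ge0 ?gaussian_rV_ge0.
have pg_ge0 (xi : 'rV[R]_n) : 0 <= \prod_i power_gaussian b r^-1 (xi ord0 i).
  by apply: prodr_ge0 => i _; exact: power_gaussian_ge0.
pose D := expR 1 * (K * kappa) ^+ 2 * Num.sqrt (pi / c) ^+ n.
have D0 : 0 <= D.
  apply: mulr_ge0; first by rewrite mulr_ge0 ?expR_ge0 ?sqr_ge0.
  by rewrite exprn_ge0// sqrtr_ge0.
have MMG (z1 z2 : 'rV[R]_n) : (0 <= (expR 1 * (M z1 * M z2 * G (z1 - z2)))%:E)%E.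
  rewrite lee_fin; apply: mulr_ge0; first exact: expR_ge0.
  by apply: mulr_ge0 (G_ge0 _); exact: mulr_ge0.
apply: (@le_trans _ _ (\int[product_sigma_finite lebesgue_rV lebesgue_rV]_z
   (expR 1 * (M z.1 * M z.2 * G (z.1 - z.2)))%:E)%E).
  apply: integral_le_ge0 => z; last exact: int_Phi.
  exact: MMG.
rewrite /product_sigma_finite fubini_tonelli1.
- rewrite /fubini_F/=.
  apply: (@le_trans _ _ (\int[lebesgue_rV]_xi (D * (weight_rV xi * \prod_i power_gaussian b r^-1 (xi ord0 i)))%:E)%E).
    apply: ge0_integral_mono => xi _.
      by apply: integral_ge0 => eta _; exact: MMG.
    rewrite mulrA EFinM -int_inner -ge0_integralZl//.
    + apply: ge0_integral_mono => eta _.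
        exact: MMG.
      rewrite -EFinM lee_fin.
      have -> : D * weight_rV xi * (weight_rV eta * gaussian_rV (4 * c)^-1 0 (xi - eta)) =
         expR 1 * (K * kappa * weight_rV xi * (K * kappa * weight_rV eta) * G (xi - eta)).
        by rewrite /D /G; move: (expR 1) => e; ring.
      rewrite ler_wpM2l ?expR_ge0// ler_wpM2r//.
      (* The heat Gaussian, having provided integrability, is bounded by 1 here; the dependence on t
         disappears. *)
      have Mle z : M z <= K * kappa * weight_rV z.
        rewrite /M /heat_bound ler_wpM2l ?mulr_ge0// ler_piMr ?weight_rV_ge0//.
        by apply: gaussian_rV_le1; exact: ltW.
      by apply: ler_pM.
    + apply/measurable_EFinP; apply: measurable_funM; first exact: measurable_weight_rV.
      by apply: measurable_gaussian_rV => //; exact: measurable_rVB.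
    + by move=> eta _; rewrite lee_fin.
    + by rewrite lee_fin mulr_ge0 ?weight_rV_ge0.
  under eq_integral do rewrite EFinM.
  rewrite ge0_integralZl//.
  + by rewrite [leRHS]EFinM; apply: (lee_wpmul2l _ int_outer); rewrite lee_fin.
  + apply/measurable_EFinP; apply: measurable_funM; first exact: measurable_weight_rV.
    by apply: (measurable_prod_coord (f := fun=> power_gaussian b r^-1)) => i; exact: measurable_power_gaussian.
  + by move=> xi _; rewrite lee_fin mulr_ge0 ?weight_rV_ge0.
- apply/measurable_EFinP; apply: measurable_funM => //; apply: measurable_funM => //.
  by apply: measurable_funM; [exact: measurableT_comp mM measurable_fst|exact: msnd].
- by move=> z; exact: MMG.
Qed.

End at_scale.
End heat_energy.

(** * From power bounds on the Fourier transform to averages over balls *)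

Section pm_heat.
Context (R : realType) (n : nat) (theta : R).
Hypotheses (n0 : (0 < n)%N) (theta0 : 0 < theta) (theta_lt : theta < n%:R / 2).
Implicit Types x y xi : 'rV[R]_n.

Let b := (n%:R - theta) / n%:R.

Let nR : 0 < n%:R :> R. Proof. by rewrite ltr0n. Qed.

Let b12 : 1 / 2 < b.
Proof. by rewrite /b ltr_pdivlMr// mul1r mulrC; move: theta_lt; lra. Qed.

Let b1 : b < 1.
Proof. by rewrite /b ltr_pdivrMr// mul1r gtrBl. Qed.

(* |xi|^{-(n-theta)} is the product of n factors |xi|^{-b} <= |xi_i|^{-b}. *)
Let enorm_weight xi : (forall i, xi ord0 i != 0) ->
  enorm xi `^ (- (n%:R - theta)) <= weight_rV b xi.
Proof.
move=> xi0.
have bn : - (n%:R - theta) = - b * n%:R by rewrite /b mulNr divfK// gt_eqF.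
rewrite bn powRrM powR_mulrn ?powR_ge0// /weight_rV -[X in _ ^+ X]card_ord -prodr_const.
apply: ler_prod => i _; rewrite powR_ge0/= /abs_powN !powRN.
have xi1 : 0 < `|xi ord0 i| by rewrite normr_gt0.
rewrite lef_pV2 ?posrE ?powR_gt0//; last exact: lt_le_trans (coord_le_enorm xi i).
apply: ge0_ler_powR; rewrite ?nnegrE ?enorm_ge0 ?coord_le_enorm//.
by move: b12; lra.
Qed.

Lemma sqr_normc (z : R[i]) : Normc.normc z ^+ 2 = complex.Re z ^+ 2 + complex.Im z ^+ 2.
Proof. by case: z => a c /=; rewrite sqr_sqrtr// addr_ge0 ?sqr_ge0. Qed.

Lemma normc_ge0 (z : R[i]) : 0 <= Normc.normc z.
Proof. by case: z => a c /=; exact: sqrtr_ge0. Qed.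

Lemma normr_Re_Im_le (z : R[i]) : `|complex.Re z| + `|complex.Im z| <= 2 * Normc.normc z.
Proof.
have h a c : `|a| <= Normc.normc (a +i* c).
  by rewrite -sqrtr_sqr /=; apply: ler_wsqrtr; rewrite lerDl sqr_ge0.
have h' a c : `|c| <= Normc.normc (a +i* c).
  by rewrite -sqrtr_sqr /=; apply: ler_wsqrtr; rewrite lerDr sqr_ge0.
by case: z => a c; rewrite mulr_natl mulr2n; apply: lerD; [exact: h|exact: h'].
Qed.

Lemma measurable_normc d (T : measurableType d) (g : T -> R[i]) :
  measurable_fun setT (fun s => complex.Re (g s)) ->
  measurable_fun setT (fun s => complex.Im (g s)) ->
  measurable_fun setT (fun s => Normc.normc (g s)).
Proof.
move=> mr mi.
have E s : Normc.normc (g s) = Num.sqrt (complex.Re (g s) ^+ 2 + complex.Im (g s) ^+ 2).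
  by case: (g s).
under eq_fun do rewrite E.
apply: (measurableT_comp (f := @Num.sqrt R)).
  by apply: continuous_measurable_fun; exact: sqrt_continuous.
by apply: measurable_funD; apply: measurable_funX.
Qed.

Variables (f : functional R n) (g : 'rV[R]_n -> R[i]) (K : R).
Hypotheses (mgr : measurable_fun setT (fun xi => complex.Re (g xi)))
           (mgi : measurable_fun setT (fun xi => complex.Im (g xi))).
Hypothesis fg : is_function (fourierD f) g.
Hypothesis K0 : 0 <= K.
Hypothesis gK : {ae @lebesgue_rV R n, forall xi : 'rV[R]_n,
  enorm xi `^ (n%:R - theta) * Normc.normc (g xi) <= K}.

(* Discarding a null set makes the pointwise bound hold everywhere. *)
Let good xi := Normc.normc (g xi) <= K * weight_rV b xi.
Let u xi := if good xi then complex.Re (g xi) else 0.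
Let v xi := if good xi then complex.Im (g xi) else 0.

Let mgood : measurable_fun setT good.
Proof.
apply: measurable_fun_ler; first exact: measurable_normc.
by apply: measurable_funM => //; exact: measurable_weight_rV.
Qed.

Let meas_u : measurable_fun setT u. Proof. exact: measurable_fun_ifT. Qed.
Let meas_v : measurable_fun setT v. Proof. exact: measurable_fun_ifT. Qed.

Let uvK xi : `|u xi| + `|v xi| <= (2 * K) * weight_rV b xi.
Proof.
rewrite /u /v; case: ifPn => [h|_].
  by apply: le_trans (normr_Re_Im_le _) _; rewrite -mulrA ler_wpM2l.
by rewrite normr0 addr0 !mulr_ge0 ?weight_rV_ge0.
Qed.

Let K20 : 0 <= 2 * K. Proof. by rewrite mulr_ge0. Qed.

Let ae_good : {ae @lebesgue_rV R n, forall xi : 'rV[R]_n, good xi}.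
Proof.
apply: filterS2 gK (@ae_coord_neq0 R n) => xi h xi0.
have e0 : 0 < enorm xi.
  by apply: lt_le_trans (coord_le_enorm xi (Ordinal n0)); rewrite normr_gt0.
apply: (@le_trans _ _ (K * enorm xi `^ (- (n%:R - theta)))); last first.
  by rewrite ler_wpM2l// enorm_weight.
by rewrite powRN ler_pdivlMr ?powR_gt0// mulrC.
Qed.

Let symbolE t y xi :
  complex.Re (g xi * heat_symbol t y xi) =
    heat_re (fun xi => complex.Re (g xi)) (fun xi => complex.Im (g xi)) t y xi /\
  complex.Im (g xi * heat_symbol t y xi) =
    heat_im (fun xi => complex.Re (g xi)) (fun xi => complex.Im (g xi)) t y xi.
Proof.
rewrite /heat_re /heat_im /heat_symbol; case: (g xi) => a c /=.
by split; ring.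
Qed.

Let ae_symbol t y : {ae @lebesgue_rV R n, forall xi : 'rV[R]_n,
  complex.Re (g xi * heat_symbol t y xi) = heat_re u v t y xi /\
  complex.Im (g xi * heat_symbol t y xi) = heat_im u v t y xi}.
Proof.
apply: filterS ae_good => xi h; have [-> ->] := symbolE t y xi.
by rewrite /heat_re /heat_im /u /v h.
Qed.

Let measurable_slice (F : 'rV[R]_n -> 'rV[R]_n -> R) y :
  measurable_fun setT (fun p : 'rV[R]_n * 'rV[R]_n => F p.1 p.2) ->
  measurable_fun setT (F y).
Proof.
move=> mF; have : measurable_fun setT (fun xi : 'rV[R]_n => (y, xi)) by exact: measurable_pair1.
exact: (measurableT_comp mF).
Qed.

Let mRe t y : measurable_fun setT (fun xi => complex.Re (g xi * heat_symbol t y xi)).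
Proof.
under eq_fun do rewrite (symbolE t y _).1.
by apply: measurable_slice; exact: measurable_heat_re.
Qed.

Let mIm t y : measurable_fun setT (fun xi => complex.Im (g xi * heat_symbol t y xi)).
Proof.
under eq_fun do rewrite (symbolE t y _).2.
by apply: measurable_slice; exact: measurable_heat_im.
Qed.

(** [g] and its truncation u + i v agree almost everywhere, so the integrals do. The integrability
    of the truncated kernel also gives [integrableC], without which [is_function] says nothing about
    the symbol. *)
Lemma heat_pmE t y : 0 < t -> heat t f y =
  (\int[lebesgue_rV]_xi heat_re u v t y xi) +i* (\int[lebesgue_rV]_xi heat_im u v t y xi).
Proof.
move=> t0.
have mr : measurable_fun setT (heat_re u v t y) by apply: measurable_slice; exact: measurable_heat_re.
have mi : measurable_fun setT (heat_im u v t y) by apply: measurable_slice; exact: measurable_heat_im.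
have ir := integrable_heat_bound b12 b1 t0 mr (heat_re_le t uvK y).
have ii := integrable_heat_bound b12 b1 t0 mi (heat_im_le t uvK y).
rewrite (heatE t0 fg).
  rewrite /cintegral; congr (_ +i* _); congr fine; apply: ae_eq_integral => //.
  - by apply/measurable_EFinP; exact: mRe.
  - by apply/measurable_EFinP.
  - by apply: filterS (ae_symbol t y) => xi [-> _].
  - by apply/measurable_EFinP; exact: mIm.
  - by apply/measurable_EFinP.
  - by apply: filterS (ae_symbol t y) => xi [_ ->].
have isum := integrableD measurableT (integrable_abse ir) (integrable_abse ii).
rewrite /integrableC.
apply: (@le_lt_trans _ _ (\int[lebesgue_rV]_xi (`|(heat_re u v t y xi)%:E| + `|(heat_im u v t y xi)%:E|))%E).
  apply: ae_ge0_le_integral => //.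
  - by move=> xi _; rewrite lee_fin normc_ge0.
  - by apply/measurable_EFinP; apply: measurable_normc; [exact: mRe|exact: mIm].
  - by move=> xi _; rewrite adde_ge0.
  - exact: (measurable_int _ isum).
  - apply: filterS (ae_symbol t y) => xi [<- <-] _.
    by rewrite -EFinD lee_fin normc_le.
have /integrableP[_] := isum.
apply: le_lt_trans; apply: ge0_integral_mono => xi _; last exact: lee_abs.
by rewrite adde_ge0.
Qed.

(** The constant of [heat_energy_le] with K replaced by 2 K, as |Re| + |Im| <= 2 |g|, and without
    K^2. The factor (n / 2)^n comes from dividing by the inscribed cube of side 2 r / n. *)
Definition sqr_bmo_const : R :=
  expR 1 * (2 * (2 * pi)^-1 ^+ n) ^+ 2 * (Num.sqrt pi * energy_const b * (n%:R / 2)) ^+ n.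

Lemma sqr_bmo_const_ge0 : 0 <= sqr_bmo_const.
Proof.
rewrite /sqr_bmo_const mulr_ge0 ?(mulr_ge0 (expR_ge0 _)) ?sqr_ge0//.
rewrite exprn_ge0// mulr_ge0 ?divr_ge0// mulr_ge0 ?sqrtr_ge0//.
have h1 : 0 <= 1 - b by rewrite subr_ge0 ltW.
have h2 : 0 <= 2 * b - 1 by move: b12; lra.
by rewrite addr_ge0 ?divr_ge0 ?sqr_ge0// mulr_ge0 ?mulr_ge0 ?sqrtr_ge0// addr_ge0// divr_ge0.
Qed.

Lemma heat_mean_le x r : 0 < r ->
  (heat_mean f x r <= (Num.sqrt sqr_bmo_const * K * r `^ (1 - theta))%:E)%E.
Proof.
move=> r0; set B := eball x r.
pose E := expR 1 * (2 * K * (2 * pi)^-1 ^+ n) ^+ 2 * Num.sqrt (pi / (r ^+ 2)^-1) ^+ n *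
     (energy_const b * r^-1 `^ (2 - 2 * b)) ^+ n.
have inner t : 0 < t -> (\int[lebesgue_rV]_(y in B) ((Normc.normc (heat t f y)) ^+ 2)%:E <= E%:E)%E.
  move=> t0; apply: le_trans (heat_energy_le b12 b1 meas_u meas_v K20 t0 uvK x r0).
  rewrite le_eqVlt; apply/orP; left; apply/eqP; apply: eq_integral => y _.
  by rewrite sqr_normc heat_pmE.
have outer : (\int[lebesgue_measure]_(t in `]0%R, (r ^+ 2)%R[)
       \int[lebesgue_rV]_(y in B) ((Normc.normc (heat t f y)) ^+ 2)%:E <= (E * r ^+ 2)%:E)%E.
  apply: (@le_trans _ _ (\int[lebesgue_measure]_(t in `]0%R, (r ^+ 2)%R[) E%:E)%E).
    apply: ge0_integral_mono => t /=.
      by move=> _; apply: integral_ge0 => y _; rewrite lee_fin sqr_ge0.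
    by rewrite in_itv/= => /andP[t0 _]; exact: inner.
  rewrite integral_cst//= lebesgue_measure_itv/= lte_fin exprn_gt0// -EFinD subr0.
  by rewrite -EFinM.
have s0 : 0 < 2 * (r / n%:R) by rewrite mulr_gt0// divr_gt0.
have muB : ((lebesgue_rV B)^-1 <= ((2 * (r / n%:R)) ^- n)%:E)%E.
  have h := eball_measure_ge x n0 r0.
  rewrite inve_ple ?inE ?measure_ge0 ?lee_fin ?invr_ge0 ?exprn_ge0 ?(ltW s0)//.
  by rewrite inver gt_eqF ?invr_gt0 ?exprn_gt0// invrK.
have X0 : (0 <= \int[lebesgue_measure]_(t in `]0%R, (r ^+ 2)%R[)
       \int[lebesgue_rV]_(y in B) ((Normc.normc (heat t f y)) ^+ 2)%:E)%E.
  by apply: integral_ge0 => t _; apply: integral_ge0 => y _; rewrite lee_fin sqr_ge0.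
have I0 : (0 <= (lebesgue_rV B)^-1)%E by rewrite inve_ge0.
have EE : (2 * (r / n%:R)) ^- n * (E * r ^+ 2) =
    (Num.sqrt sqr_bmo_const * K * r `^ (1 - theta)) ^+ 2.
  rewrite [RHS]exprMn [(_ * K) ^+ 2]exprMn sqr_sqrtr ?sqr_bmo_const_ge0// /E /sqr_bmo_const.
  have -> : Num.sqrt (pi / (r ^+ 2)^-1) = Num.sqrt pi * r.
    by rewrite invrK sqrtrM ?pi_ge0// sqrtr_sqr gtr0_norm.
  (* The exponents match because (2 - 2 b) n = 2 theta. *)
  have -> : (r `^ (1 - theta)) ^+ 2 = r ^+ 2 * (r^-1 `^ (2 - 2 * b)) ^+ n.
    rewrite -!powR_mulrn ?powR_ge0 ?(ltW r0)// -powR_inv1 ?(ltW r0)// -!powRrM.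
    rewrite -powRD ?(gt_eqF r0) ?implybT//; congr (_ `^ _).
    by rewrite /b; field; rewrite gt_eqF.
  move: (r^-1 `^ (2 - 2 * b)) (energy_const b) (Num.sqrt pi) (expR 1) ((2 * pi)^-1 ^+ n).
  move=> p ec s e k; rewrite -exprVn.
  transitivity (e * (2 * K * k) ^+ 2 * r ^+ 2 * ((2 * (r / n%:R))^-1 * (s * r) * (ec * p)) ^+ n).
    by rewrite !exprMn; ring.
  have -> : (2 * (r / n%:R))^-1 * (s * r) * (ec * p) = s * ec * (n%:R / 2) * p.
    by field; rewrite !gt_eqF.
  by rewrite [(s * ec * _ * p) ^+ n]exprMn; ring.
have C0 : 0 <= Num.sqrt sqr_bmo_const * K * r `^ (1 - theta).
  by rewrite mulr_ge0 ?powR_ge0// mulr_ge0 ?sqrtr_ge0.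
rewrite /heat_mean -/B.
apply: (@le_trans _ _ (poweR ((Num.sqrt sqr_bmo_const * K * r `^ (1 - theta)) ^+ 2)%:E 2^-1)); last first.
  by rewrite poweR_EFin lee_fin powR12_sqrt ?sqr_ge0// sqrtr_sqr ger0_norm.
apply: gt0_ler_poweR; rewrite ?in_itv/= ?leey ?andbT ?mule_ge0 ?lee_fin ?sqr_ge0//.
by rewrite -EE EFinM; apply: lee_pmul.
Qed.

End pm_heat.

(** * Pointwise bound on majorizing kernels *)

Section power_comparison.
Context (R : realType).

Lemma powR_le_infty (q D r0 : R) : (forall r, 0 < r -> r0 < r -> r `^ q <= D) -> q <= 0.
Proof.
move=> H; rewrite leNgt; apply/negP => q0.
(* At [s] the power equals |D| + 1, already above D; the second entry of the maximum pushes r beyond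
   [r0]. *)
pose s := (`|D| + 1) `^ q^-1; pose r := Num.max s (`|r0| + 1).
have s0 : 0 < s by rewrite powR_gt0// ltr_wpDl.
have sr : s <= r by rewrite le_max lexx.
have r0r : `|r0| + 1 <= r by rewrite le_max lexx orbT.
have rgt : 0 < r by exact: lt_le_trans sr.
have rr0 : r0 < r by apply: lt_le_trans r0r; rewrite ltr_pwDr// ler_norm.
have h1 := H r rgt rr0.
have h2 : `|D| + 1 <= r `^ q.
  have D1 : 0 <= `|D| + 1 by rewrite addr_ge0.
  have <- : s `^ q = `|D| + 1 by rewrite -powRrM mulVf ?lt0r_neq0// powRr1.
  by apply: ge0_ler_powR; rewrite ?nnegrE ?(ltW q0) ?(ltW s0) ?(ltW rgt).
have := ler_norm D; lra.
Qed.

Lemma powR_le_zero (q D e : R) : 0 < e ->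
  (forall r, 0 < r -> r < e -> r `^ q <= D) -> 0 <= q.
Proof.
move=> e0 H; rewrite -oppr_le0; apply: (@powR_le_infty _ D e^-1) => r r0 er.
have := H r^-1; rewrite invr_gt0 => /(_ r0).
have re : r^-1 < e by rewrite invf_plt.
by move=> /(_ re); rewrite -powR_inv1 ?(ltW r0)// -powRrM mulN1r.
Qed.

End power_comparison.

Section kernel_bound.
Context (R : realType) (n : nat).
Hypothesis n0 : (0 < n)%N.
Implicit Types xi eta : 'rV[R]_n.

Let nR : 0 < n%:R :> R. Proof. by rewrite ltr0n. Qed.

Lemma near0_enorm (P : 'rV[R]_n -> Prop) : (\forall xi \near (0 : 'rV[R]_n)^', P xi) ->
  exists2 e : R, 0 < e & forall xi, xi != 0 -> enorm xi < e -> P xi.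
Proof.
move=> /nbhs_ballP[e /= e0 He]; exists e => // xi xi0 xie; apply: He => //.
split=> // i j; rewrite (ord1 i) /ball/= mxE sub0r normrN.
exact: le_lt_trans (coord_le_enorm xi j) xie.
Qed.

Lemma nbhs0_eball (e : R) : 0 < e -> nbhs (0 : 'rV[R]_n) [set xi | enorm xi < e].
Proof.
move=> e0; apply/nbhs_ballP; exists (e / n%:R); first by rewrite /= divr_gt0.
move=> xi /= [_ h]; apply: enorm_lt_box => // i.
by have := h ord0 i; rewrite /ball/= mxE sub0r normrN.
Qed.

(** The cube of half-side |xi| / (4 n) about xi / 2 is symmetric under eta -> xi - eta, and there
    both points have norm between |xi| / 4 and 3 |xi| / 4. Asking for the lower bound on an annulus
    comparable to |xi| lets one lemma serve both xi -> 0 and |xi| -> oo. *)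
Lemma convolution_ge (h : 'rV[R]_n -> \bar R) (c p : R) xi :
  0 <= p -> 0 < c -> xi != 0 -> (forall eta, 0 <= h eta)%E ->
  (forall eta, (enorm xi / 4 < enorm eta)%R -> (enorm eta < enorm xi)%R -> (c * enorm eta `^ (- p))%:E <= h eta)%E ->
  (((c * enorm xi `^ (- p)) ^+ 2 * (enorm xi / (2 * n%:R)) ^+ n)%:E <=
   \int[lebesgue_rV]_eta (h (xi - eta)%R * h eta))%E.
Proof.
move=> p0 c0 xi0 h0 hc; set rho := enorm xi.
have rho0 : 0 < rho by rewrite enorm_gt0.
have s0 : 0 < rho / 4 / n%:R by rewrite !divr_gt0.
set q := c * rho `^ (- p).
have q0 : 0 <= q by rewrite mulr_ge0 ?powR_ge0// ltW.
have -> : (q ^+ 2 * (rho / (2 * n%:R)) ^+ n)%:E =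
  (\int[lebesgue_rV]_eta ((q ^+ 2)%:E * (box_indic (2^-1 *: xi) (rho / 4 / n%:R) eta)%:E))%E.
  rewrite ge0_integralZl//.
  - rewrite integral_box_indic// -EFinM; congr (_ * _ ^+ _)%:E.
    by field; rewrite gt_eqF.
  - apply/measurable_EFinP; apply: (measurable_prod_coord
      (f := fun i => \1_([set` `](2^-1 *: xi) ord0 i - rho / 4 / n%:R, (2^-1 *: xi) ord0 i + rho / 4 / n%:R[%R]))) => i.
    exact: measurable_indic.
  - by move=> eta _; rewrite lee_fin; apply: prodr_ge0 => i _; rewrite indicE.
  - by rewrite lee_fin sqr_ge0.
apply: ge0_integral_mono => eta _.
  rewrite mule_ge0 ?lee_fin ?sqr_ge0//; apply: prodr_ge0 => i _; rewrite indicE//.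
have half : enorm (2^-1 *: xi) = rho / 2 by rewrite enormZ gtr0_norm// mulrC.
have [->|[-> hbox]] := box_indicP (2^-1 *: xi) (rho / 4 / n%:R) eta.
  by rewrite mule0 mule_ge0.
have d1 : enorm (eta - 2^-1 *: xi) < rho / 4.
  by apply: enorm_lt_box => //; rewrite divr_gt0.
have key zeta : enorm (zeta - 2^-1 *: xi) < rho / 4 -> (q%:E <= h zeta)%E.
  move=> dz; have up := enormD (2^-1 *: xi) (zeta - 2^-1 *: xi).
  have lo := enormD zeta (2^-1 *: xi - zeta).
  rewrite addrC subrK in up; rewrite addrC subrK -opprB enormN in lo.
  rewrite half in up lo.
  have z1 : rho / 4 < enorm zeta by lra.
  have z2 : enorm zeta < rho by lra.
  apply: le_trans (hc _ z1 z2); rewrite lee_fin ler_wpM2l ?(ltW c0)//.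
  have z0 : 0 < enorm zeta by apply: lt_trans z1; rewrite divr_gt0.
  rewrite !powRN lef_pV2 ?posrE ?powR_gt0//.
  by apply: ge0_ler_powR; rewrite ?nnegrE ?enorm_ge0// ltW.
have k1 := key eta d1.
have k2 : (q%:E <= h (xi - eta)%R)%E.
  apply: key; rewrite (_ : _ - _ = - (eta - 2^-1 *: xi)) ?enormN//.
  by apply/rowP => i; rewrite !mxE; field.
by rewrite mule1 expr2 EFinM; apply: lee_pmul.
Qed.

(* Compare the lower bound r^{n - 2p} for the convolution with the upper bound
   r^{theta - p} given by the majorization inequality, r = |xi|. *)
Lemma kernel_power_le (h : 'rV[R]_n -> \bar R) (theta p c C B : R) xi :
  0 <= p -> 0 < c -> 0 < B -> 0 <= C -> xi != 0 -> (forall eta, 0 <= h eta)%E ->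
  (forall eta, (enorm xi / 4 < enorm eta)%R -> (enorm eta < enorm xi)%R -> (c * enorm eta `^ (- p))%:E <= h eta)%E ->
  (h xi <= (C * enorm xi `^ (- p))%:E)%E ->
  (\int[lebesgue_rV]_eta (h (xi - eta)%R * h eta) <= B%:E * weighted theta h xi)%E ->
  enorm xi `^ (n%:R - theta - p) <= B * C * (2 * n%:R) ^+ n / c ^+ 2.
Proof.
move=> p0 c0 B0 C0 xi0 h0 hc hC hB.
have rho0 : 0 < enorm xi by rewrite enorm_gt0.
have := convolution_ge p0 c0 xi0 h0 hc.
move=> /le_trans/(_ hB) H.
(* Finiteness selects the ordinary branch of [weighted]. *)
have hfin : h xi \is a fin_num by rewrite ge0_fin_numE// (le_lt_trans hC)// ltry.
have {H} : (((c * enorm xi `^ (- p)) ^+ 2 * (enorm xi / (2 * n%:R)) ^+ n)%:E <=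
    (B * (enorm xi `^ theta * (C * enorm xi `^ (- p))))%:E)%E.
  apply: (le_trans H); rewrite /weighted; case: eqP => [hoo|_].
    by move: hfin; rewrite hoo.
  by rewrite !EFinM lee_wpmul2l ?lee_fin ?(ltW B0)// lee_wpmul2l ?lee_fin ?powR_ge0.
rewrite lee_fin; set rho := enorm xi in rho0 *.
set P := rho `^ (- p) => H.
have P0 : 0 < P by rewrite powR_gt0.
have T0 : 0 < rho `^ theta by rewrite powR_gt0.
have -> : rho `^ (n%:R - theta - p) = rho ^+ n * P / rho `^ theta.
  rewrite /P -powR_mulrn ?(ltW rho0)// -powRN -!powRD ?(gt_eqF rho0) ?implybT//.
  by congr (_ `^ _); ring.
rewrite ler_pdivrMr// -(ler_pM2l P0) -(ler_pM2l (exprn_gt0 2 c0)).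
rewrite -(@ler_pM2r _ (((2 * n%:R) ^+ n)^-1)) ?invr_gt0 ?exprn_gt0 ?mulr_gt0//.
apply: le_trans (le_trans H _); rewrite le_eqVlt; apply/orP; left; apply/eqP.
  by rewrite expr_div_n exprMn; ring.
by field; rewrite expf_neq0 ?mulf_neq0 ?gt_eqF.
Qed.

Variables (theta alpha omega : R) (h : 'rV[R]_n -> \bar R).
Hypotheses (theta_lt : theta < n%:R) (alpha0 : 0 <= alpha) (omega0 : 0 <= omega).
Hypothesis hH : majorizing_kernel_growth theta alpha omega h.

Let delta_enorm (r : R) : 0 < r -> {xi : 'rV[R]_n | enorm xi = r & xi != 0}.
Proof.
move=> r0; exists (r *: delta_mx ord0 (Ordinal n0)).
  by rewrite enormZ enorm_delta mulr1 gtr0_norm.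
by rewrite -enorm_gt0 enormZ enorm_delta mulr1 gtr0_norm.
Qed.

Let h0 : forall eta, (0 <= h eta)%E.
Proof. by move=> eta; have [[_ /(_ eta)/ltW]] := hH. Qed.

(** The growth conditions give a constant of unknown sign; the maximum with 1 makes it
    invertible. *)
Let lower_pos (p C : R) eta : eta != 0 -> ((enorm eta `^ (- p))%:E <= C%:E * h eta)%E ->
  (((Num.max C 1)^-1 * enorm eta `^ (- p))%:E <= h eta)%E.
Proof.
move=> eta0 H; set m := Num.max C 1.
have m0 : 0 < m by rewrite lt_max ltr01 orbT.
rewrite EFinM -lee_pdivlMl ?invr_gt0// invrK.
by apply: (le_trans H); rewrite lee_wpmul2r// lee_fin le_max lexx.
Qed.

Let alpha_le : alpha <= n%:R - theta.
Proof.
have [[_ _ [B B0 hB] _] [[C1 hC1] [C2 hC2] _ _ _]] := hH.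
have [e1 e10 H1] := near0_enorm hC1; have [e2 e20 H2] := near0_enorm hC2.
rewrite -subr_ge0; set c := (Num.max C2 1)^-1.
have c0 : 0 < c by rewrite invr_gt0 lt_max ltr01 orbT.
apply: (@powR_le_zero _ _ (B * `|C1| * (2 * n%:R) ^+ n / c ^+ 2) (Num.min e1 e2)).
  by rewrite lt_min e10.
move=> r r0; rewrite lt_min => /andP[r1 r2].
have [xi xir xi0] := delta_enorm r0; rewrite -xir.
apply: (@kernel_power_le h _ _ c `|C1| B xi) => //.
- move=> eta eta1 eta2; apply: lower_pos.
    by rewrite -enorm_gt0; apply: lt_trans eta1; rewrite divr_gt0// xir.
  apply: H2; last by apply: lt_trans eta2 _; rewrite xir.
  by rewrite -enorm_gt0; apply: lt_trans eta1; rewrite divr_gt0// xir.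
- apply: le_trans (H1 _ xi0 _) _; first by rewrite xir.
  by rewrite lee_fin ler_wpM2r ?powR_ge0// ler_norm.
Qed.

Let omega_ge : n%:R - theta <= omega.
Proof.
have [[_ _ [B B0 hB] _] [_ _ [C1 [r1 H1]] [C2 [r2 H2]] _]] := hH.
rewrite -subr_le0; set c := (Num.max C2 1)^-1.
have c0 : 0 < c by rewrite invr_gt0 lt_max ltr01 orbT.
(* The relevant eta satisfy |eta| > |xi| / 4, so |xi| > 4 r2 keeps them where the lower bound at
   infinity holds. *)
apply: (@powR_le_infty _ _ (B * `|C1| * (2 * n%:R) ^+ n / c ^+ 2) (Num.max r1 (4 * r2))).
move=> r r0; rewrite gt_max => /andP[rr1 rr2].
have [xi xir xi0] := delta_enorm r0; rewrite -xir.
apply: (@kernel_power_le h _ _ c `|C1| B xi) => //.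
- move=> eta eta1 _; apply: lower_pos.
    by rewrite -enorm_gt0; apply: lt_trans eta1; rewrite divr_gt0// xir.
  by apply: H2; apply: lt_trans eta1; rewrite xir; lra.
- apply: (le_trans (H1 _ _)); first by rewrite xir.
  by rewrite lee_fin ler_wpM2r ?powR_ge0// ler_norm.
Qed.

Lemma majorizing_kernel_le : exists2 C : R, 0 < C &
  forall xi, xi != 0 -> (h xi <= (C * enorm xi `^ (theta - n%:R))%:E)%E.
Proof.
have [_ [[C1 hC1] _ [C2 [r2 H2]] _ hM]] := hH.
have [e1 e10 H1] := near0_enorm hC1.
(* With e <= 1 <= r, the inequalities alpha <= n - theta <= omega turn into inequalities between
   powers of |xi| on the inner and outer regions. In between, [M] bounds the kernel and |xi|^{theta
   - n} >= r^{theta - n}. *)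
pose e := Num.min e1 1; have e0 : 0 < e by rewrite lt_min e10 ltr01.
pose r := Num.max r2 1; have r1 : 1 <= r by rewrite le_max lexx orbT.
have [M HM] := hM _ (nbhs0_eball e0).
have nt0 : 0 <= n%:R - theta by rewrite subr_ge0 ltW.
have K0 : 0 <= `|M| * r `^ (n%:R - theta) by rewrite mulr_ge0 ?powR_ge0.
exists (`|C1| + `|C2| + `|M| * r `^ (n%:R - theta) + 1).
  by rewrite ltr_wpDl// addr_ge0// addr_ge0.
move=> xi xi0; have rho0 : 0 < enorm xi by rewrite enorm_gt0.
have P0 : 0 < enorm xi `^ (theta - n%:R) by rewrite powR_gt0.
have weaken (a : R) : (h xi <= (a * enorm xi `^ (theta - n%:R))%:E)%E ->
    a <= `|C1| + `|C2| + `|M| * r `^ (n%:R - theta) + 1 ->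
    (h xi <= ((`|C1| + `|C2| + `|M| * r `^ (n%:R - theta) + 1) * enorm xi `^ (theta - n%:R))%:E)%E.
  by move=> ha aC; apply: (le_trans ha); rewrite lee_fin ler_wpM2r// ltW.
have nC1 := normr_ge0 C1; have nC2 := normr_ge0 C2.
have [xie|exi] := ltP (enorm xi) e.
  apply: (weaken `|C1|); last lra.
  move: xie; rewrite lt_min => /andP[xie1 xi1].
  apply: le_trans (H1 _ xi0 xie1) _; rewrite lee_fin.
  apply: (@le_trans _ _ (`|C1| * enorm xi `^ (- alpha))).
    by rewrite ler_wpM2r ?powR_ge0// ler_norm.
  rewrite ler_wpM2l//; apply: ger_powR; first by rewrite rho0 ltW.
  by move: alpha_le; lra.
have [rxi|xir] := ltP r (enorm xi).
  apply: (weaken `|C2|); last lra.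
  apply: (le_trans (H2 _ _)).
    by apply: le_lt_trans rxi; rewrite le_max lexx.
  rewrite lee_fin; apply: (@le_trans _ _ (`|C2| * enorm xi `^ (- omega))).
    by rewrite ler_wpM2r ?powR_ge0// ler_norm.
  rewrite ler_wpM2l//; apply: ler_powR; first exact: le_trans r1 (ltW rxi).
  by move: omega_ge; lra.
apply: (weaken (`|M| * r `^ (n%:R - theta))); last lra.
apply: le_trans (HM _ _) _; first by apply/negP; rewrite -leNgt.
rewrite lee_fin -mulrA (le_trans (ler_norm M))// ler_peMr//.
rewrite -(opprB n%:R theta) powRN ler_pdivlMr ?powR_gt0// mul1r.
by apply: ge0_ler_powR; rewrite ?nnegrE ?enorm_ge0// (le_trans ler01 r1).
Qed.

End kernel_bound.

(** * Embeddings *)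

Section embeddings.
Context (R : realType) (n : nat).
Hypothesis n0 : (0 < n)%N.

Lemma embedded_vectors T m (X Y : normed_space R T) :
  (forall f, carrier X f -> (0 <= norm_of X f)%E) ->
  embedded X Y -> embedded (vectors m X) (vectors m Y).
Proof.
move=> X0 [XY [C C0 HC]]; split=> [f Xf j|]; first exact: XY.
exists C => // f Xf /=; rewrite ge0_sume_distrr; last by move=> j _; exact: X0.
by apply: lee_sum => j _; exact: HC.
Qed.

Lemma PM_norm_ge0 a (f : functional R n) : (0 <= PM_norm a f)%E.
Proof.
apply: ess_sup_gee; first exact: lebesgue_rV_setT_gt0.
by apply: nearW => xi; rewrite lee_fin mulr_ge0 ?powR_ge0 ?normc_ge0.
Qed.

Lemma fhatP (f : functional R n) : fourier_L1loc f ->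
  L1loc (fhat f) /\ is_function (fourierD f) (fhat f).
Proof.
by move=> ex_g; exact: (@xgetPex _ (fun=> 0) [set g | L1loc g /\ is_function (fourierD f) g]).
Qed.

(** Common source of both embeddings: r^{1 - theta} equals 1 for theta = 1, which permits all radii,
    and for theta < 1 it is at most sqrt(T)^{1 - theta} when r^2 < T. *)
Lemma PM_heat_mean_le (theta : R) : 0 < theta -> theta < n%:R / 2 ->
  exists2 C : R, 0 < C & forall f, carrier (PM n (n%:R - theta)) f ->
  forall x r, 0 < r ->
    (heat_mean f x r <= (C * r `^ (1 - theta))%:E * PM_norm (n%:R - theta) f)%E.
Proof.
move=> theta0 theta_lt; exists (Num.sqrt (sqr_bmo_const n theta) + 1).
  by rewrite ltr_wpDl// sqrtr_ge0.
move=> f [_ /fhatP[[mr mi _] fg] fPM] x r r0.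
have N0 := PM_norm_ge0 (n%:R - theta) f.
have fin : PM_norm (n%:R - theta) f \is a fin_num by rewrite ge0_fin_numE.
have gK : {ae @lebesgue_rV R n, forall xi : 'rV[R]_n,
    enorm xi `^ (n%:R - theta) * Normc.normc (fhat f xi) <= fine (PM_norm (n%:R - theta) f)}.
  apply: filterS (ess_sup_ge (@lebesgue_rV R n) (fun xi => (enorm xi `^ (n%:R - theta) * Normc.normc (fhat f xi))%:E)) => xi.
  by rewrite -lee_fin fineK.
have := heat_mean_le n0 theta0 theta_lt mr mi fg (fine_ge0 N0) gK x r0.
move=> /le_trans; apply; rewrite -[in leRHS](fineK fin) -EFinM lee_fin mulrAC.
rewrite ler_wpM2r ?fine_ge0// ler_wpM2r ?powR_ge0//.
by rewrite lerDl.
Qed.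

Lemma PM_embedded_BMOm1 : 1 < n%:R / 2 :> R -> embedded (PM n (n%:R - 1)) (BMOm1 R n).
Proof.
move=> n2; have [C C0 HC] := PM_heat_mean_le ltr01 n2.
have bound f : carrier (PM n (n%:R - 1)) f -> (BMOm1_norm f <= C%:E * PM_norm (n%:R - 1) f)%E.
  move=> Xf; apply: ge_ereal_sup => _ [x [r [r0 ->]]].
  by have := HC f Xf x r r0; rewrite subrr powRr0 mulr1.
split; last by exists C.
move=> f Xf; have [tf _ fPM] := Xf; split=> //.
apply: le_lt_trans (bound f Xf) _; rewrite lte_mul_pinfty ?lee_fin ?(ltW C0)//.
Qed.

Lemma PM_embedded_BMOm1T (theta T : R) : 0 < theta -> theta < 1 -> theta < n%:R / 2 -> 0 < T ->
  embedded (PM n (n%:R - theta)) (BMOm1T n T).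
Proof.
move=> theta0 theta1 theta_lt T0; have [C C0 HC] := PM_heat_mean_le theta0 theta_lt.
pose C' := C * Num.sqrt T `^ (1 - theta).
have C'0 : 0 < C' by rewrite mulr_gt0// powR_gt0// sqrtr_gt0.
have bound f : carrier (PM n (n%:R - theta)) f ->
    (BMOm1T_norm T f <= C'%:E * PM_norm (n%:R - theta) f)%E.
  move=> Xf; apply: ge_ereal_sup => _ [x [r [r0 rT ->]]].
  apply: le_trans (HC f Xf x r r0) _; rewrite lee_wpmul2r ?PM_norm_ge0//.
  rewrite lee_fin ler_wpM2l ?(ltW C0)//.
  have rs : r <= Num.sqrt T by rewrite -[r](ger0_norm (ltW r0)) -sqrtr_sqr ler_wsqrtr// ltW.
  by apply: ge0_ler_powR; rewrite ?nnegrE ?sqrtr_ge0 ?(ltW r0) ?subr_ge0 ?(ltW theta1).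
split; last by exists C'.
move=> f Xf; have [tf _ fPM] := Xf; split=> //.
by apply: le_lt_trans (bound f Xf) _; rewrite lte_mul_pinfty ?lee_fin ?(ltW C'0).
Qed.

Lemma majorization_embedded_PM (theta alpha omega : R) (h : 'rV[R]_n -> \bar R) :
  theta < n%:R -> 0 <= alpha -> 0 <= omega ->
  majorizing_kernel_growth theta alpha omega h ->
  embedded (majorization_space h) (vectors n (PM n (n%:R - theta))).
Proof.
move=> theta_lt alpha0 omega0 hH.
have [C C0 HC] := majorizing_kernel_le n0 theta_lt alpha0 omega0 hH.
have h_gt0 xi : (0 < h xi)%E by have [[_ + _ _] _] := hH; exact.
have bound f j : (PM_norm (n%:R - theta) (f j) <= C%:E * majorization_norm h f)%E.
  apply/ess_supP; apply: filterS (ess_sup_ge (@lebesgue_rV R n)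
    (fun xi => (h xi)^-1 * (Num.sqrt (\sum_(j < n) Normc.normc (fhat (f j) xi) ^+ 2))%:E)%E) => xi.
  rewrite -/(majorization_norm h f); set s := Num.sqrt _ => Hxi.
  have s0 : 0 <= s := sqrtr_ge0 _.
  have gs : Normc.normc (fhat (f j) xi) <= s.
    rewrite -[leLHS](ger0_norm (normc_ge0 _)) -sqrtr_sqr ler_wsqrtr// (bigD1 j)//= lerDl.
    by apply: sumr_ge0 => i _; rewrite sqr_ge0.
  apply: le_trans (lee_wpmul2l _ Hxi); last by rewrite lee_fin ltW.
  have [->|xi0] := eqVneq xi 0.
    have -> : enorm (0 : 'rV[R]_n) = 0 by apply/eqP; rewrite enorm_eq0.
    rewrite powR0 ?subr_eq0 ?gt_eqF// mul0r !mule_ge0 ?lee_fin ?(ltW C0)//.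
    by rewrite inve_ge0 ltW.
  have rho0 : 0 < enorm xi by rewrite enorm_gt0.
  move: (HC xi xi0) (h_gt0 xi); case: (h xi) => [k| |]//=.
  rewrite !lee_fin lte_fin => kC k0.
  rewrite inver gt_eqF// -!EFinM lee_fin mulrA ler_pM ?powR_ge0 ?normc_ge0//.
  rewrite ler_pdivlMr// mulrC.
  have -> : C = C * enorm xi `^ (theta - n%:R) * enorm xi `^ (n%:R - theta).
    by rewrite -mulrA -powRD ?(gt_eqF rho0) ?implybT// addrA subrK subrr powRr0 mulr1.
  by rewrite ler_wpM2r ?powR_ge0.
(* The target norm is a sum over n components, each at most C times the norm of the whole vector. *)
have nC : 0 < n%:R * C by rewrite mulr_gt0// ltr0n.
split=> [f [tf lf Nf] j /=|].
  split=> //; apply: le_lt_trans (bound f j) _.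
  have N0 : (0 <= majorization_norm h f)%E.
    apply: ess_sup_gee; first exact: lebesgue_rV_setT_gt0.
    by apply: nearW => xi; rewrite mule_ge0 ?inve_ge0 ?(ltW (h_gt0 xi)) ?lee_fin ?sqrtr_ge0.
  by rewrite lte_mul_pinfty ?lee_fin ?(ltW C0).
exists (n%:R * C) => // f _ /=.
apply: (@le_trans _ _ (\sum_(j < n) C%:E * majorization_norm h f)%E).
  by apply: lee_sum => j _; exact: bound.
rewrite -ge0_sume_distrl; last by move=> j _; rewrite lee_fin ltW.
by rewrite sumEFin sumr_const card_ord mulr_natl.
Qed.

End embeddings.

Theorem theorem12 (R : realType) (n : nat) (theta alpha omega : R)
    (h : 'rV[R]_n -> \bar R) :
  (2 <= n)%N -> 0 <= theta -> theta < n%:R / 2 -> 0 <= alpha -> 0 < omega ->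
  majorizing_kernel_growth theta alpha omega h ->
  (theta = 1 ->
     embedded (majorization_space h) (vectors n (PM n (n%:R - 1))) /\
     forall m : nat,
       embedded (vectors m (PM n (n%:R - 1))) (vectors m (BMOm1 R n))) /\
  (0 < theta -> theta < 1 ->
     embedded (majorization_space h) (vectors n (PM n (n%:R - theta))) /\
     forall T : R, 0 < T -> forall m : nat,
       embedded (vectors m (PM n (n%:R - theta))) (vectors m (BMOm1T n T))).
Proof.
move=> n2 _ theta_lt alpha0 omega0 hH.
have n0 : (0 < n)%N by apply: leq_trans n2.
have theta_n : theta < n%:R.
  by apply: lt_le_trans theta_lt _; rewrite ler_pdivrMr// ler_peMr// ler1n.
have A := majorization_embedded_PM n0 theta_n alpha0 (ltW omega0) hH.
split=> [theta1|theta0 theta1].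
  rewrite theta1 in A theta_lt; split=> // m.
  by apply: embedded_vectors; [move=> f _; exact: PM_norm_ge0|exact: PM_embedded_BMOm1].
split=> // T T0 m.
by apply: embedded_vectors; [move=> f _; exact: PM_norm_ge0|exact: PM_embedded_BMOm1T].
Qed.
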